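(* Let $R$ be a domain and let $\mathcal{M}$ be an $R$-matroid of rank $r$ on the ground set $[n]$. Suppose that $\mathcal{M}(\emptyset)$ is torsion-free and that $\mathcal{M}([n])=0$. Then for every $i\in[n]$, the following holds in $L_0(R\text{-mod})[x,y]$: \[ T_{\mathcal{M}}(x,y)=\begin{cases} y\,T_{\mathcal{M}\setminus i}(x,y) & \text{if } i \text{ is a loop},\\ x\,T_{\mathcal{M}/i}(x,y) & \text{if } i \text{ is a coloop},\\ T_{\mathcal{M}\setminus i}(x,y)+T_{\mathcal{M}/i}(x,y) & \text{otherwise.}\end{cases} \]
   Context: $[n]=\{1,\dots,n\}$; $R$ is a (commutative) domain with field of fractions $Q(R)$; $R$-mod is the category of finitely generated $R$-modules. An $R$-matroid on a finite ground set $E$ (e.g. $E=[n]$) is a function $\mathcal{M}:2^{E}\to R\text{-mod}$ (values matter up to isomorphism) such that for every $A\subseteq E$ and $b,c\in E\setminus A$ there are $x,y\in\mathcal{M}(A)$ with $\mathcal{M}(A\cup\{b\})\simeq\mathcal{M}(A)/(x)$, $\mathcal{M}(A\cup\{c\})\simeq\mathcal{M}(A)/(y)$, $\mathcal{M}(A\cup\{b,c\})\simeq\mathcal{M}(A)/(x,y)$. For $i\in[n]$, the deletion $\mathcal{M}\setminus i$ and contraction $\mathcal{M}/i$ are the $R$-matroids on $[n]\setminus\{i\}$ given by $(\mathcal{M}\setminus i)(A)=\mathcal{M}(A)$ and $(\mathcal{M}/i)(A)=\mathcal{M}(A\cup\{i\})$. Rank, loops, coloops refer to the generic matroid of $\mathcal{M}$,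 the classical matroid on $E$ with rank function $\operatorname{rk}(A)=\operatorname{rk}_{\mathcal{M}}(A)=\dim_{Q(R)}(\mathcal{M}(\emptyset)\otimes_R Q(R))-\dim_{Q(R)}(\mathcal{M}(A)\otimes_R Q(R))$. The rank of $\mathcal{M}$ is $r=\operatorname{rk}(E)$. A loop is an $i$ with $\operatorname{rk}(\{i\})=0$; a coloop is an $i$ with $\operatorname{rk}(E\setminus\{i\})=r-1$. $\operatorname{tor}(A)=\operatorname{tor}_{\mathcal{M}}(A)$ is the torsion submodule of $\mathcal{M}(A)$, and $N^\vee=\operatorname{Hom}_R(N,Q(R)/R)$. $L_0(R\text{-mod})$ is the commutative ring freely generated as an abelian group by the isomorphism classes $[N]$ of finitely generated $R$-modules, with product $[N][N']=[N\oplus N']$ (no relations from exact sequences). It is understood that the modules $\operatorname{tor}(A)^\vee$ are finitely generated, so that $[\operatorname{tor}(A)^\vee]\in L_0(R\text{-mod})$. The Tutte polynomial of an $R$-matroid $\mathcal{M}$ of rank $r$ on $E$ is \[T_{\mathcal{M}}(x,y)=\sum_{A\subseteq E}[\operatorname{tor}(A)^\vee](x-1)^{r-\operatorname{rk}(A)}(y-1)^{|A|-\operatorname{rk}(A)}\in L_0(R\text{-mod})[x,y],\] where for $\mathcal{M}\setminus i$ and $\mathcal{M}/i$ one uses their own rank functions, ranks, and torsion modules. *)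

(* Defs.v *)
From HB Require Import structures.
From mathcomp Require Import all_boot all_order all_algebra.
From mathcomp Require Import boolp classical_sets functions.
From mathcomp Require Import monalg mpoly.

Set Implicit Arguments.
Unset Strict Implicit.
Unset Printing Implicit Defensive.

Import GRing.Theory.
Local Open Scope ring_scope.
Local Open Scope quotient_scope.

Definition modiso (R : nzRingType) (U V : lmodType R) : Prop :=
  exists f : {linear U -> V}, bijective f.

Notation "U ≃ V" := (modiso U V) (at level 70, no associativity).

Section ModIso.
Variable R : nzRingType.
Implicit Types U V W : lmodType R.

Lemma modiso_refl U : U ≃ U.
Proof. by exists idfun; exists idfun. Qed.

Lemma modiso_sym U V : U ≃ V -> V ≃ U.
Proof.
case=> f [g fK gK].
have glin : linear g.
  by move=> a u v; apply: (can_inj fK); rewrite linearP !gK.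
pose gL := GRing.isLinear.Build R V U *:%R g glin.
pose h : {linear V -> U} := HB.pack g gL.
by exists h; exists f.
Qed.

Lemma modiso_trans U V W : U ≃ V -> V ≃ W -> U ≃ W.
Proof.
case=> f bf [g bg].
by exists (g \o f : {linear U -> W}); exact: bij_comp.
Qed.

Lemma modiso_prod U V U' V' : U ≃ U' -> V ≃ V' -> (U * V)%type ≃ (U' * V')%type.
Proof.
case=> f [f' fK f'K] [g [g' gK g'K]].
pose h (p : U * V) : U' * V' := (f p.1, g p.2).
have hlin : linear h by move=> a u v; rewrite /h /= !linearP.
pose hL := GRing.isLinear.Build R _ _ *:%R h hlin.
exists (HB.pack h hL : {linear _ -> _}); exists (fun p => (f' p.1, g' p.2)).
  by case=> u v; rewrite /= /h /= fK gK.
by case=> u v; rewrite /= /h /= f'K g'K.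
Qed.

End ModIso.

Section Submodules.
Variables (R : nzRingType) (V : lmodType R).

Section Span.
Variable G : set V.

Definition lspan : {pred V} := fun v =>
  `[< exists (n : nat) (c : 'I_n -> R) (g : 'I_n -> V),
      (forall i, G (g i)) /\ v = \sum_i c i *: g i >].

Lemma lspanP v : reflect (exists (n : nat) (c : 'I_n -> R) (g : 'I_n -> V),
      (forall i, G (g i)) /\ v = \sum_i c i *: g i) (v \in lspan).
Proof. exact: asboolP. Qed.

Lemma lspan_submod : submod_closed lspan.
Proof.
split.
  by apply/lspanP; exists 0%N, (fun=> 0), (fun=> 0); split; [case|rewrite big_ord0].
move=> a u v /lspanP[n [c [g [Gg ->]]]] /lspanP[m [d [h [Gh ->]]]].
apply/lspanP; exists (n + m)%N.
exists (fun i : 'I_(n + m) => match fintype.split i with inl j => a * c j | inr k => d k end).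
exists (fun i : 'I_(n + m) => match fintype.split i with inl j => g j | inr k => h k end).
split; first by move=> i; case: fintype.split.
rewrite big_split_ord scaler_sumr /=; congr (_ + _); apply: eq_bigr => i _.
  by case: split_ordP => j /eqP; rewrite ?eq_lshift ?eq_lrshift // => /eqP <-; rewrite scalerA.
by case: split_ordP => j /eqP; rewrite ?eq_rshift ?eq_rlshift // => /eqP <-.
Qed.

HB.instance Definition _ := GRing.isSubmodClosed.Build R V lspan lspan_submod.

Lemma mem_lspan v : G v -> v \in lspan.
Proof.
move=> Gv; apply/lspanP; exists 1%N, (fun=> 1), (fun=> v); split=> //.
by rewrite big_ord1 scale1r.
Qed.

End Span.

Variable S : submodClosed V.

Record submod := Submod { submod_val :> V; _ : submod_val \in S }.

HB.instance Definition _ := [isSub for submod_val].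
HB.instance Definition _ := [Choice of submod by <:].
HB.instance Definition _ := [SubChoice_isSubLmodule of submod by <:].

Definition submod_pred : {pred V} := fun v => v \in S.

HB.instance Definition _ := GRing.isZmodClosed.Build V submod_pred
  (GRing.submod_closedB (GRing.submodClosedP S)).

Definition modquot := Quotient.quot submod_pred.

HB.instance Definition _ := GRing.Zmodule.on modquot.
HB.instance Definition _ := ZmodQuotient.on modquot.

Definition modquot_scale (a : R) (x : modquot) : modquot :=
  \pi_modquot (a *: repr x).

Lemma pi_modquot_eq (u v : V) : (\pi_modquot u == \pi_modquot v) = (u - v \in S).
Proof. by rewrite -[LHS](Quotient.idealrBE (submod_pred : zmodClosed V)). Qed.

Lemma pi_scale a (v : V) : modquot_scale a (\pi_modquot v) = \pi_modquot (a *: v).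
Proof.
apply/eqP; rewrite pi_modquot_eq -scalerBr rpredZ //.
by rewrite -pi_modquot_eq reprK.
Qed.

Lemma modquot_scalerA a b x :
  modquot_scale a (modquot_scale b x) = modquot_scale (a * b) x.
Proof. by rewrite -[x]reprK (pi_scale b) (pi_scale a) (pi_scale (a * b)) scalerA. Qed.

Lemma modquot_scale1r : left_id 1 modquot_scale.
Proof. by move=> x; rewrite -[x]reprK pi_scale scale1r. Qed.

Lemma modquot_scalerDr : right_distributive modquot_scale +%R.
Proof.
move=> a x y; rewrite -[x]reprK -[y]reprK.
by rewrite -raddfD !(pi_scale a) -raddfD scalerDr.
Qed.

Lemma modquot_scalerDl x : {morph modquot_scale^~ x : a b / a + b}.
Proof. by move=> a b; rewrite -[x]reprK !pi_scale -raddfD scalerDl. Qed.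

HB.instance Definition _ := GRing.Zmodule_isLmodule.Build R modquot
  modquot_scalerA modquot_scale1r modquot_scalerDr modquot_scalerDl.

Definition modproj (v : V) : modquot := \pi_modquot v.

Lemma modproj_linear : linear modproj.
Proof.
move=> a u v; rewrite /modproj raddfD; congr (_ + _).
exact/esym/(pi_scale a u).
Qed.

HB.instance Definition _ :=
  GRing.isLinear.Build R V modquot *:%R modproj modproj_linear.

Lemma modproj_eq u v : (modproj u == modproj v) = (u - v \in S).
Proof. exact: pi_modquot_eq. Qed.

Lemma modproj_surj (x : modquot) : exists v, x = modproj v.
Proof. by exists (repr x); rewrite /modproj reprK. Qed.

End Submodules.

Lemma first_iso (R : nzRingType) (U V : lmodType R) (f : {linear U -> V}) :
  (forall v, exists u, f u = v) -> exists K : submodClosed U, V ≃ modquot K.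
Proof.
move=> fsurj; pose K : {pred U} := fun u => f u == 0.
have Ksub : submod_closed K.
  split; first by apply/eqP; exact: raddf0.
  move=> a u v /eqP fu /eqP fv; apply/eqP.
  by rewrite linearP fu fv scaler0 addr0.
pose KS : submodClosed U := HB.pack K (GRing.isSubmodClosed.Build R U K Ksub).
exists KS; apply: modiso_sym.
pose g (x : modquot KS) : V := f (repr x).
have gE u : g (modproj KS u) = f u.
  have : repr (modproj KS u) - u \in KS by rewrite -modproj_eq /modproj reprK.
  by change (f (repr (modproj KS u) - u) == 0 -> g (modproj KS u) = f u);
    rewrite raddfB subr_eq0 => /eqP.
have glin : linear g.
  move=> a x y; have [[u ->] [v ->]] := (modproj_surj x, modproj_surj y).
  by rewrite -linearP !gE linearP.
exists (HB.pack g (GRing.isLinear.Build R _ _ *:%R g glin) : {linear _ -> _}).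
have /choice[s sK] := fsurj.
exists (fun v => modproj KS (s v)) => [x|v]; last by rewrite /= gE sK.
have [u ->] := modproj_surj x; apply/eqP; rewrite /= gE modproj_eq.
by change (f (s (f u) - u) == 0); rewrite raddfB subr_eq0; apply/eqP/sK.
Qed.

Definition finitely_generated (R : nzRingType) (V : lmodType R) : Prop :=
  exists X : seq V, forall v, v \in lspan [set x | x \in X]%classic.

Record fgModType (R : nzRingType) := FgMod {
  fgmod_sort :> lmodType R;
  fgmodP : finitely_generated fgmod_sort
}.

Section IsoClasses.
Variable R : nzRingType.

Lemma finitely_generated_row (V : lmodType R) :
  finitely_generated V <->
  exists n (f : {linear 'rV[R]_n -> V}), forall v, exists u, f u = v.
Proof.
split=> [[X XV]|[n [f fsurj]]].
  exists (size X); pose f (u : 'rV[R]_(size X)) := \sum_i u 0 i *: X`_i.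
  have flin : linear f.
    move=> a u v; rewrite /f scaler_sumr -big_split; apply: eq_bigr => i _ /=.
    by rewrite !mxE scalerDl scalerA.
  pose fL : {linear 'rV[R]_(size X) -> V} :=
    HB.pack f (GRing.isLinear.Build R _ _ *:%R f flin).
  exists fL => v; have /lspanP[n [c [g [gX ->]]]] := XV v.
  have /choice[h hE] i : exists u, fL u = g i.
    have gi : (index (g i) X < size X)%N by rewrite index_mem; exact: gX.
    exists (delta_mx 0 (Ordinal gi)); rewrite /= /f (bigD1 (Ordinal gi)) //=.
    rewrite mxE !eqxx scale1r nth_index; last exact: gX.
    rewrite big1 ?addr0 // => j jNi; rewrite mxE (negPf jNi) andbF.
    by rewrite scale0r.
  exists (\sum_i c i *: h i); rewrite raddf_sum; apply: eq_bigr => i _.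
  by rewrite -hE; exact: linearZ_LR.
exists [seq f (delta_mx 0 i) | i <- enum 'I_n] => v; have [u <-] := fsurj v.
apply/lspanP; exists n, (u 0), (fun i => f (delta_mx 0 i)); split=> [i|].
  by apply/mapP; exists i; rewrite ?mem_enum.
rewrite {1}[u]row_sum_delta raddf_sum; apply: eq_bigr => i _.
exact: linearZ_LR.
Qed.

Lemma fg_iso (V W : lmodType R) :
  V ≃ W -> finitely_generated V -> finitely_generated W.
Proof.
case=> h [h' _ hK] /finitely_generated_row[n [f fsurj]].
apply/finitely_generated_row; exists n, (h \o f) => w.
by have [u fu] := fsurj (h' w); exists u; rewrite /= fu.
Qed.

Lemma fg_rV n : finitely_generated 'rV[R]_n.
Proof. by apply/finitely_generated_row; exists n, idfun => v; exists v. Qed.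

Lemma fg_quot n (S : submodClosed 'rV[R]_n) : finitely_generated (modquot S).
Proof.
apply/finitely_generated_row; exists n, (modproj S) => v.
by have [u ->] := modproj_surj v; exists u.
Qed.

Lemma fg_prod (V W : lmodType R) : finitely_generated V ->
  finitely_generated W -> finitely_generated (V * W)%type.
Proof.
move=> /finitely_generated_row[n [f fs]] /finitely_generated_row[m [g gs]].
apply/finitely_generated_row; exists (n + m)%N.
pose h (u : 'rV[R]_(n + m)) : V * W := (f (lsubmx u), g (rsubmx u)).
have hlin : linear h by move=> a u v; rewrite /h !linearP.
exists (HB.pack h (GRing.isLinear.Build R _ _ *:%R h hlin) : {linear _ -> _}).
case=> v w; have [[a fa] [b gb]] := (fs v, gs w).
by exists (row_mx a b); rewrite /= /h row_mxKl row_mxKr fa gb.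
Qed.

(* The class of all finitely generated R-modules is too large to be quotiented
   into a ring.  Every finitely generated R-module is isomorphic to some
   R^n / K, so the isomorphism classes are those of the modules R^n / K. *)
Definition presentation := {n : nat & submodClosed 'rV[R]_n}.

Definition presmod (P : presentation) : fgModType R :=
  FgMod (fg_quot (tagged P)).

HB.instance Definition _ := gen_eqMixin presentation.
HB.instance Definition _ := gen_choiceMixin presentation.

Definition pres_iso (P Q : presentation) : bool := `[< presmod P ≃ presmod Q >].

Lemma pres_iso_equiv : equiv_class_of pres_iso.
Proof.
split=> [P|P Q|P Q T]; first exact/asboolP/modiso_refl.
  by apply/asboolP/asboolP; exact: modiso_sym.
by move=> /asboolP QP /asboolP PT; apply/asboolP; exact: modiso_trans QP PT.
Qed.

Canonical pres_iso_rel := EquivRelPack pres_iso_equiv.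
Canonical pres_iso_encModRel := defaultEncModRel pres_iso.

Definition isoclass := {eq_quot pres_iso}.

HB.instance Definition _ := EqQuotient.on isoclass.
HB.instance Definition _ := Choice.on isoclass.

Lemma presmodP (V : fgModType R) : exists P, V ≃ presmod P.
Proof.
have /finitely_generated_row[n [f fsurj]] := fgmodP V.
by have [K VK] := first_iso fsurj; exists (existT _ n K).
Qed.

Definition isocls (V : fgModType R) : isoclass :=
  \pi_isoclass (sval (cid (presmodP V))).

Definition isorepr (x : isoclass) : fgModType R := presmod (repr x).

Lemma isoclsP (V W : fgModType R) : isocls V = isocls W <-> V ≃ W.
Proof.
rewrite /isocls; case: cid => P VP; case: cid => Q WQ /=.
split=> [/eqP|VW]; last apply/eqP; rewrite piE.
  by move=> /asboolP PQ; apply: modiso_trans VP (modiso_trans PQ _); exact: modiso_sym.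
apply/asboolP; apply: modiso_trans (modiso_sym VP) _.
exact: modiso_trans VW WQ.
Qed.

Lemma isoreprK (x : isoclass) : isocls (isorepr x) = x.
Proof.
rewrite /isocls /isorepr; case: cid => P xP /=; rewrite -[RHS]reprK.
by apply/eqP; rewrite piE; apply/asboolP; exact: modiso_sym.
Qed.

Lemma isoreprE (V : fgModType R) : isorepr (isocls V) ≃ V.
Proof. by apply/isoclsP; rewrite isoreprK. Qed.

Definition fgprod (V W : fgModType R) : fgModType R :=
  FgMod (fg_prod (fgmodP V) (fgmodP W)).

Definition isoclass_one : isoclass := isocls (FgMod (fg_rV 0)).

Definition isoclass_mul (x y : isoclass) : isoclass :=
  isocls (fgprod (isorepr x) (isorepr y)).

Lemma isocls_prod (V W : fgModType R) :
  isocls (fgprod V W) = isoclass_mul (isocls V) (isocls W).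
Proof.
by apply/isoclsP/modiso_prod; apply: modiso_sym; exact: isoreprE.
Qed.

Lemma isoclass_mulC : commutative isoclass_mul.
Proof.
move=> x y; apply/isoclsP.
pose h (p : isorepr x * isorepr y) := (p.2, p.1).
have hlin : linear h by [].
exists (HB.pack h (GRing.isLinear.Build R _ _ *:%R h hlin) : {linear _ -> _}).
by exists (fun p => (p.2, p.1)); case.
Qed.

Lemma isoclass_mulA : associative isoclass_mul.
Proof.
move=> x y z; rewrite -[x]isoreprK -[y]isoreprK -[z]isoreprK -!isocls_prod.
set U := isorepr x; set V := isorepr y; set W := isorepr z.
apply/isoclsP; pose h (p : U * (V * W)) := ((p.1, p.2.1), p.2.2).
have hlin : linear h by [].
exists (HB.pack h (GRing.isLinear.Build R _ _ *:%R h hlin) : {linear _ -> _}).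
by exists (fun p => (p.1.1, (p.1.2, p.2))) => [[? []]|[[]]].
Qed.

Lemma isoclass_mul1 : left_id isoclass_one isoclass_mul.
Proof.
move=> x; rewrite -[x]isoreprK -isocls_prod; apply/isoclsP.
pose h (p : 'rV[R]_0 * isorepr x) := p.2.
have hlin : linear h by [].
exists (HB.pack h (GRing.isLinear.Build R _ _ *:%R h hlin) : {linear _ -> _}).
by exists (fun v => (0, v)) => // -[u v]; rewrite /= /h [u]thinmx0.
Qed.

Lemma isoclass_mulr1 : right_id isoclass_one isoclass_mul.
Proof. by move=> x; rewrite isoclass_mulC isoclass_mul1. Qed.

Lemma isocls1P (V : fgModType R) :
  isocls V = isoclass_one <-> forall v : V, v = 0.
Proof.
split=> [/isoclsP[f [g fK gK]] v|V0]; last apply/isoclsP.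
  by rewrite -[v]fK [f v]thinmx0 -(thinmx0 (f 0)) fK.
pose h (v : V) : 'rV[R]_0 := 0.
have hlin : linear h by move=> a u v; rewrite /h scaler0 addr0.
exists (HB.pack h (GRing.isLinear.Build R _ _ *:%R h hlin) : {linear _ -> _}).
by exists (fun=> 0) => [v|v]; rewrite ?[v]V0 ?[v]thinmx0.
Qed.

Lemma isoclass_unitm x y : isoclass_mul x y = isoclass_one ->
  x = isoclass_one /\ y = isoclass_one.
Proof.
move=> /isocls1P xy0; rewrite -[x]isoreprK -[y]isoreprK.
split; apply/isocls1P => v; first by have [] := xy0 (v, 0).
by have [] := xy0 (0, v).
Qed.

HB.instance Definition _ := Choice_isMonomialDef.Build isoclass
  isoclass_mulA isoclass_mul1 isoclass_mulr1 isoclass_unitm.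
HB.instance Definition _ :=
  MonomialDef_isConomialDef.Build isoclass isoclass_mulC.

(* The monoid ring Z[isoclass]: freely generated as an abelian group by the
   isomorphism classes, with [V] * [W] = [V (+) W]. *)
Definition L0 : comNzRingType := {malg int[isoclass]}.

Definition L0class (V : fgModType R) : L0 := << isocls V >>.

Lemma L0class_eq (V W : fgModType R) : V ≃ W -> L0class V = L0class W.
Proof. by move=> /isoclsP VW; rewrite /L0class VW. Qed.

Lemma L0class_prod (V W : fgModType R) :
  L0class (fgprod V W) = L0class V * L0class W.
Proof. by rewrite /L0class isocls_prod malgM_def fgmulUU mulr1. Qed.

End IsoClasses.

Section TorsionDual.
Variable R : idomainType.
Implicit Types U V : lmodType R.

Definition torsion_pred V : {pred V} :=
  fun v => `[< exists2 r : R, r != 0 & r *: v = 0 >].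

Lemma torsion_submod V : submod_closed (@torsion_pred V).
Proof.
split; first by apply/asboolP; exists 1; rewrite ?oner_eq0 ?scaler0.
move=> a u v /asboolP[r r0 ru] /asboolP[s s0 sv]; apply/asboolP.
exists (r * s); first by rewrite mulf_neq0.
rewrite scalerDr -[(r * s) *: v]scalerA sv scaler0 addr0 scalerA.
by rewrite -mulrA mulrC -scalerA ru scaler0.
Qed.

HB.instance Definition _ V :=
  GRing.isSubmodClosed.Build R V (@torsion_pred V) (@torsion_submod V).

Definition torsion V : lmodType R := submod (@torsion_pred V).

Definition torsion_free V : Prop :=
  forall (r : R) (v : V), r *: v = 0 -> r = 0 \/ v = 0.

(* Hom_R(U, V), as a submodule of the module of all functions U -> V. *)
Definition linear_pred U V : {pred U -> V} := fun f => `[< linear f >].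

Lemma linear_pred_submod U V : submod_closed (@linear_pred U V).
Proof.
split; first by apply/asboolP => a u v; rewrite scaler0 addr0.
move=> a f g /asboolP fL /asboolP gL; apply/asboolP => b u v.
change (a *: f (b *: u + v) + g (b *: u + v) =
        b *: (a *: f u + g u) + (a *: f v + g v)).
by rewrite fL gL !scalerDr !scalerA [b * a]mulrC addrACA.
Qed.

HB.instance Definition _ U V := GRing.isSubmodClosed.Build R (U -> V)
  (@linear_pred U V) (@linear_pred_submod U V).

Definition Hom U V : lmodType R := submod (@linear_pred U V).

(* Q(R), seen as an R-module. *)
Definition fracmod : Type := {fraction R}.

HB.instance Definition _ := GRing.Zmodule.on fracmod.

Definition fracmod_scale (r : R) (q : fracmod) : fracmod :=
  tofrac r * (q : {fraction R}).

Lemma fracmod_scalerA a b x :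
  fracmod_scale a (fracmod_scale b x) = fracmod_scale (a * b) x.
Proof. by rewrite /fracmod_scale mulrA -rmorphM. Qed.

Lemma fracmod_scale1r : left_id 1 fracmod_scale.
Proof. by move=> x; rewrite /fracmod_scale rmorph1 mul1r. Qed.

Lemma fracmod_scalerDr : right_distributive fracmod_scale +%R.
Proof. by move=> a x y; rewrite /fracmod_scale [LHS]mulrDr. Qed.

Lemma fracmod_scalerDl x : {morph fracmod_scale^~ x : a b / a + b}.
Proof. by move=> a b; rewrite /fracmod_scale rmorphD [LHS]mulrDl. Qed.

HB.instance Definition _ := GRing.Zmodule_isLmodule.Build R fracmod
  fracmod_scalerA fracmod_scale1r fracmod_scalerDr fracmod_scalerDl.

Definition integral_pred : {pred fracmod} :=
  fun q => `[< exists r : R, q = tofrac r >].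

Lemma integral_submod : submod_closed integral_pred.
Proof.
split; first by apply/asboolP; exists 0; rewrite rmorph0.
move=> a u v /asboolP[r ->] /asboolP[s ->]; apply/asboolP.
by exists (a * r + s); rewrite rmorphD rmorphM.
Qed.

HB.instance Definition _ :=
  GRing.isSubmodClosed.Build R fracmod integral_pred integral_submod.

Definition dual V : lmodType R := Hom V (modquot integral_pred).

(* U (x)_R Q(R) as a vector space over Q(R): the free vector space on the
   symbols u (x) q modulo the bilinearity relations, Q(R) acting on the right
   factor. *)
Inductive tensor_rel U : {malg {fraction R}[(U * {fraction R})%type]} -> Prop :=
| tensor_addl u u' q :
    tensor_rel (<< (u + u', q) >> - << (u, q) >> - << (u', q) >>)
| tensor_addr u q q' :
    tensor_rel (<< (u, q + q') >> - << (u, q) >> - << (u, q') >>)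
| tensor_bal r u q :
    tensor_rel (<< (r *: u, q) >> - << (u, tofrac r * q) >>)
| tensor_act c u q :
    tensor_rel (<< (u, c * q) >> - c *: << (u, q) >>).

Definition tensor_frac U : lmodType {fraction R} :=
  modquot (lspan (@tensor_rel U)).

End TorsionDual.

(* The dimension of a finite-dimensional vector space (0 in the infinite-
   dimensional case, which does not arise for finitely generated modules). *)
Definition vdim (K : fieldType) (V : lmodType K) : nat :=
  xget 0%N [set d | 'rV[K]_d ≃ V]%classic.

Lemma vdim_eq (K : fieldType) (V : lmodType K) d : 'rV[K]_d ≃ V -> vdim V = d.
Proof.
move=> dV; rewrite /vdim; case: xgetP => [e _ eV|/(_ d)//].
have [f [g fK gK]] := modiso_trans eV (modiso_sym dV).
have fE u : f u = u *m lin1_mx f by rewrite mul_rV_lin1.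
have rkf : row_free (lin1_mx f).
  apply/inj_row_free => u; rewrite -fE => fu0.
  by rewrite -[u]fK fu0 -[0](raddf0 f) fK.
have rkF : row_full (lin1_mx f).
  apply/row_fullP; exists (\matrix_i g (delta_mx 0 i)).
  apply/row_matrixP => i; by rewrite row_mul rowK -fE gK row1.
by move: rkf rkF; rewrite /row_free /row_full => /eqP -> /eqP.
Qed.

Record Rmatroid (R : idomainType) (E : finType) := RMatroid {
  rmat :> {set E} -> fgModType R;
  rmatP : forall (A : {set E}) (b c : E), b \notin A -> c \notin A ->
    exists x y : rmat A,
      [/\ rmat (A :|: [set b]) ≃ modquot (lspan [set x]%classic),
          rmat (A :|: [set c]) ≃ modquot (lspan [set y]%classic) &
          rmat (A :|: [set b; c]) ≃ modquot (lspan [set x; y]%classic)]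
}.

Section MatroidTheory.
Variables (R : idomainType) (E : finType) (M : Rmatroid R E).

(* Natural-number subtraction: the dimension of M(A) (x) Q(R) is at most that
   of M(empty) (x) Q(R), since M(A) is a quotient of M(empty). *)
Definition rk (A : {set E}) : nat :=
  (vdim (tensor_frac (M finset.set0)) - vdim (tensor_frac (M A)))%N.

Definition loop (i : E) : Prop := rk [set i] = 0%N.

(* rk(E \ i) = rk(E) - 1, without truncated subtraction. *)
Definition coloop (i : E) : Prop := (rk (~: [set i])).+1 = rk [set: E].

Section Minors.
Variable i : E.
Let E' : finType := {j : E | j != i}.

Lemma deletionP (A : {set E'}) (b c : E') : b \notin A -> c \notin A ->
  exists x y : M (val @: A),
    [/\ M (val @: (A :|: [set b])) ≃ modquot (lspan [set x]%classic),
        M (val @: (A :|: [set c])) ≃ modquot (lspan [set y]%classic) &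
        M (val @: (A :|: [set b; c])) ≃ modquot (lspan [set x; y]%classic)].
Proof.
move=> bA cA; rewrite !imsetU !imset_set1; apply: rmatP.
  by rewrite mem_imset //; exact: val_inj.
by rewrite mem_imset //; exact: val_inj.
Qed.

Definition deletion : Rmatroid R E' := RMatroid deletionP.

Lemma contractionP (A : {set E'}) (b c : E') : b \notin A -> c \notin A ->
  exists x y : M (val @: A :|: [set i]),
    [/\ M (val @: (A :|: [set b]) :|: [set i]) ≃ modquot (lspan [set x]%classic),
        M (val @: (A :|: [set c]) :|: [set i]) ≃ modquot (lspan [set y]%classic) &
        M (val @: (A :|: [set b; c]) :|: [set i])
          ≃ modquot (lspan [set x; y]%classic)].
Proof.
move=> bA cA; rewrite !imsetU !imset_set1 ![_ :|: _ :|: [set i]]finset.setUAC.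
have valN (a : E') : a \notin A -> val a \notin val @: A :|: [set i].
  move=> aA; rewrite !inE negb_or mem_imset ?aA ?(valP a) //; exact: val_inj.
by apply: rmatP; exact: valN.
Qed.

Definition contraction : Rmatroid R E' := RMatroid contractionP.

End Minors.

End MatroidTheory.

Section Tutte.
Variable R : idomainType.

(* The class of V in L_0(R-mod); the value 0 is a dummy for modules that are
   not finitely generated. *)
Definition L0cls (V : lmodType R) : L0 R :=
  if pselect (finitely_generated V) is left Vfg then L0class (FgMod Vfg) else 0.

(* monalg and mpoly both define the notation {mpoly _[_]}. *)
Definition tx : mpoly 2 (L0 R) := 'X_ord0.
Definition ty : mpoly 2 (L0 R) := 'X_ord_max.

(* The exponents never involve a truncation: rk(A) <= rk(E) and rk(A) <= #|A|. *)
Definition tutte (E : finType) (M : Rmatroid R E) : mpoly 2 (L0 R) :=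
  \sum_(A : {set E}) L0cls (dual (torsion (M A))) *:
    ((tx - 1) ^+ (rk M [set: E] - rk M A) * (ty - 1) ^+ (#|A| - rk M A)).

Lemma L0clsE (V : fgModType R) : L0cls V = L0class V.
Proof.
rewrite /L0cls; case: pselect => [Vfg|[]]; last exact: fgmodP.
by apply: (@L0class_eq _ (FgMod Vfg) V); exact: modiso_refl.
Qed.

End Tutte.

(* Main.v *)
From HB Require Import structures.
Require Import Defs.
From mathcomp Require Import all_boot all_order all_algebra finmap.
From mathcomp Require Import boolp functions.
From mathcomp Require Import monalg mpoly.
From mathcomp Require Import zify.

(** Splitting the sum that defines the Tutte polynomial according to whether the
    subset contains [i] reduces the recursion to a comparison of [M (A + i)]
    with [M A] for [A] not containing [i].  If [i] is neither a loop nor a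
    coloop, the two halves of the sum are already the polynomials of the
    deletion and of the contraction ([tutte_other]).

    If [i] is a loop, then [M (A + i)] is isomorphic to [M A] ([loop_modiso]):
    this holds at the empty set because [M] is torsion-free there, and it
    propagates because [M (A + i)], when isomorphic to [M A], can only be its
    quotient by 0.

    If [i] is a coloop, then [M A] is isomorphic to [M (A + i) (+) R]
    ([coloop_modiso]), so both have the same torsion.  The axiom at [A] and
    [b], [i] exhibits [M (A + b + i)] as a quotient of [M (A + b)] by some [y];
    by induction the two differ by a free summand, but this need not be the
    summand spanned by [y].  Over a noetherian ring Miyata's theorem says that
    [y] does split off.  Over a general domain this fails, and the finiteness of
    the modules [tor(A)^v] has to be used: it implies that [Ext^1 (M A, R)] is
    finitely generated for all [A] ([matroid_ext_fg]), and a surjective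
    endomorphism of such a module is injective ([surj_endo_inj_mod]), which is
    what the splitting requires ([split_of_iso]).

    The ranks of the generic matroid are computed from coordinates over the
    field of fractions ([has_rank]), which determine the dimension of the tensor
    product ([has_rank_vdim]). *)

Set Implicit Arguments.
Unset Strict Implicit.
Unset Printing Implicit Defensive.

Import GRing.Theory.
Local Open Scope ring_scope.

(** * Modules and quotients *)

Section Quotients.
Variable R : nzRingType.
Implicit Types U V W : lmodType R.

Lemma linear_fun U V (f : U -> V) :
  linear f -> exists g : {linear U -> V}, g =1 f.
Proof.
move=> fL.
by exists (HB.pack f (GRing.isLinear.Build R U V *:%R f fL) : {linear U -> V}).
Qed.

Lemma linear_factor U V W (f : {linear U -> V}) (h : {linear U -> W}) :
    (forall v, exists u, f u = v) -> (forall u, f u = 0 -> h u = 0) ->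
  exists g : {linear V -> W}, forall u, g (f u) = h u.
Proof.
move=> /choice[s fs] fh.
have hE u v : f u = f v -> h u = h v.
  by move=> /eqP; rewrite -subr_eq0 -raddfB => /eqP/fh/eqP;
    rewrite raddfB subr_eq0 => /eqP.
have [a u v|g gE] := @linear_fun V W (h \o s); last first.
  by exists g => u; rewrite gE; apply: hE; rewrite fs.
by rewrite -linearP; apply: hE; rewrite linearP !fs.
Qed.

(** Quotient modules are handled through surjections with a prescribed kernel,
    so that iterated quotients never have to be formed. *)
Definition quotient_by U V (x : U) (f : {linear U -> V}) : Prop :=
  (forall v, exists u, f u = v) /\
  (forall u, f u = 0 <-> exists r, u = r *: x).

Definition quotient_by2 U V (x y : U) (f : {linear U -> V}) : Prop :=
  (forall v, exists u, f u = v) /\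
  (forall u, f u = 0 <-> exists r s, u = r *: x + s *: y).

Lemma quotient_bij U V (f : {linear U -> V}) :
  (forall v, exists u, f u = v) -> (forall u, f u = 0 -> u = 0) -> U ≃ V.
Proof.
move=> /choice[s fs] f0; exists f; exists s => // u.
by apply/eqP; rewrite -subr_eq0; apply/eqP/f0; rewrite linearB fs subrr.
Qed.

Lemma modiso_quotient V (U : lmodType R) (G : U -> Prop) :
    V ≃ modquot (lspan G) ->
  exists2 f : {linear U -> V}, (forall v, exists u, f u = v) &
    forall u, f u = 0 <-> u \in lspan G.
Proof.
move=> /modiso_sym[g [g' gK g'K]].
exists (g \o modproj (lspan G)) => [v|u].
  by have [u gu] := modproj_surj (g' v); exists u; rewrite /= -gu.
rewrite -[u in u \in _]subr0 -(modproj_eq (lspan G)) linear0 /=.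
split=> [|/eqP->]; last exact: raddf0.
by move=> gu0; rewrite -[modproj _ u]gK gu0 -(raddf0 g) gK.
Qed.

Lemma lspan1 U (G : U -> Prop) x : (forall v, G v <-> v = x) ->
  forall u, u \in lspan G <-> exists r, u = r *: x.
Proof.
move=> Gx u; split=> [/lspanP[n [c [g [Gg ->]]]]|[r ->]].
  exists (\sum_i c i); rewrite scaler_suml; apply: eq_bigr => i _.
  by congr (_ *: _); exact/Gx.
by rewrite rpredZ // mem_lspan //; exact/Gx.
Qed.

Lemma lspan2 U (G : U -> Prop) x y : (forall v, G v <-> v = x \/ v = y) ->
  forall u, u \in lspan G <-> exists r s, u = r *: x + s *: y.
Proof.
move=> Gxy u; split=> [/lspanP[n [c [g [Gg ->]]]]|[r [s ->]]]; last first.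
  by rewrite rpredD ?rpredZ // mem_lspan //; apply/Gxy; [left|right].
elim: n c g Gg => [|n IHn] c g Gg.
  by exists 0, 0; rewrite big_ord0 !scale0r addr0.
have [r [s rs]] :=
  IHn (fun i => c (lift ord0 i)) (fun i => g (lift ord0 i))
    (fun i => Gg (lift ord0 i)).
rewrite big_ord_recl rs.
have [-> | ->] := proj1 (Gxy _) (Gg ord0).
  by exists (c ord0 + r), s; rewrite scalerDl addrA.
by exists r, (c ord0 + s); rewrite scalerDl addrCA.
Qed.

End Quotients.

Section SubmodClosed.
Variables (R : nzRingType) (V : lmodType R) (S : submodClosed V).

Lemma submodN u : (- u \in S) = (u \in S).
Proof.
apply/idP/idP => uS; last by rewrite -scaleN1r rpredZ.
by rewrite -[u]opprK -scaleN1r rpredZ.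
Qed.

Lemma submodB u v : u \in S -> v \in S -> u - v \in S.
Proof. by move=> uS vS; rewrite rpredD // submodN. Qed.

Lemma submodBC u v : (u - v \in S) = (v - u \in S).
Proof. by rewrite -opprB submodN. Qed.

End SubmodClosed.

(** * Surjective endomorphisms of finitely generated modules *)

Lemma horner_mx_sum (R : comNzRingType) n (A : 'M[R]_n.+1) (p : {poly R}) :
  horner_mx A p = \sum_(k < size p) p`_k *: A ^+ k.
Proof.
rewrite -{1}[p]coefK poly_def raddf_sum; apply: eq_bigr => k _ /=.
by rewrite horner_mxZ rmorphXn /= horner_mx_X.
Qed.

(** A surjective endomorphism of a finitely generated module is injective,
    stated for a module given as a quotient of [D] by [S] inside [V], because
    the module to which it is applied is a quotient of a module of functions.
    Let [h] generate [D] modulo [S], and let [L] be the resulting map from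
    [R^n].  Lifting the generators through [psi] gives a matrix [A] with
    [psi (L (u A)) = L u] modulo [S], hence [psi^k (L (u A^k)) = L u].  Applying
    [psi^n o L] to the Cayley-Hamilton identity of [A] expresses [L u] as a
    combination of the [psi^j (L u)] with [j > 0], so [psi v] in [S] forces [v]
    in [S]. *)
Lemma surj_endo_inj_mod (R : comNzRingType) (V : lmodType R) (D : V -> Prop)
    (S : submodClosed V) (psi : {linear V -> V}) n (h : 'I_n -> V) :
    (forall i, D (h i)) ->
    (forall v, D v -> exists c : 'I_n -> R, v - \sum_i c i *: h i \in S) ->
    (forall v, v \in S -> psi v \in S) ->
    (forall v, D v -> exists2 w, D w & psi w - v \in S) ->
  forall v, D v -> psi v \in S -> v \in S.
Proof.
move=> hD gen psiS onto v Dv psiv.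
have iterS k u : u \in S -> iter k psi u \in S.
  by move=> uS; elim: k => //= k; exact: psiS.
have iter_lin k a u w :
    iter k psi (a *: u + w) = a *: iter k psi u + iter k psi w.
  by elim: k => //= k ->; rewrite linearP.
have /choice[w /all_and2[wD wP]] i : exists w, D w /\ psi w - h i \in S.
  by have [w] := onto _ (hD i); exists w.
have /choice[c cP] i := gen _ (wD i).
have [e eP] := gen _ Dv.
have [n0|n_gt0] := posnP n.
  by move: eP; rewrite big1 ?subr0 // => -[k kn] _; exfalso; rewrite n0 in kn.
case: n n_gt0 => // n _ in h hD gen w wD wP c cP e eP *.
pose A : 'M[R]_n.+1 := \matrix_(i, j) c i j.
pose L (u : 'rV[R]_n.+1) := \sum_i u 0 i *: h i.
have L_lin a u u' : L (a *: u + u') = a *: L u + L u'.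
  rewrite /L scaler_sumr -big_split; apply: eq_bigr => i _ /=.
  by rewrite !mxE scalerDl scalerA.
pose LL : {linear 'rV[R]_n.+1 -> V} :=
  HB.pack L (GRing.isLinear.Build R _ _ *:%R L L_lin).
have psiL u : psi (L (u *m A)) - L u \in S.
  have -> : L (u *m A) = \sum_i u 0 i *: \sum_j c i j *: h j.
    rewrite /L; under eq_bigr => j _ do rewrite mxE scaler_suml.
    rewrite exchange_big; apply: eq_bigr => i _ /=; rewrite scaler_sumr.
    by apply: eq_bigr => j _; rewrite mxE scalerA.
  rewrite linear_sum -sumrB rpred_sum // => i _.
  rewrite linearZ -scalerBr rpredZ //.
  rewrite -[psi _](subrK (psi (w i))) -addrA rpredD //.
  by rewrite -linearB; apply: psiS; rewrite submodBC.
have psiLk k u : iter k psi (L (u *m A ^+ k)) - L u \in S.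
  elim: k => [|k IHk] in u *; first by rewrite expr0 mulmx1 subrr rpred0.
  rewrite exprSr mulmxA iterSr.
  rewrite -(subrK (iter k psi (L (u *m A ^+ k))) (iter _ _ _)) -addrA.
  rewrite rpredD // addrC.
  have := iter_lin k (-1) (L (u *m A ^+ k)) (psi (L (u *m A ^+ k *m A))).
  by rewrite !scaleN1r => <-; apply: iterS; rewrite addrC.
pose u : 'rV_n.+1 := \row_i e i.
have vL : v - L u \in S.
  by rewrite /L; under eq_bigr => i _ do rewrite mxE.
suff LS : L u \in S by rewrite -(subrK (L u) v) rpredD.
pose p := char_poly A.
have p_size : size p = n.+2 by rewrite size_char_poly.
have p_lead : p`_n.+1 = 1.
  by have /monicP := char_poly_monic A; rewrite /lead_coef p_size.
have CH : \sum_(k < n.+2) p`_k *: iter n.+1 psi (L (u *m A ^+ k)) = 0.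
  have iter_sum (F : 'I_n.+2 -> V) (a : 'I_n.+2 -> R) k :
      iter k psi (\sum_i a i *: F i) = \sum_i a i *: iter k psi (F i).
    elim: k => //= k ->; rewrite linear_sum; apply: eq_bigr => i _.
    by rewrite linearZ.
  rewrite -iter_sum.
  have -> : \sum_(k < n.+2) p`_k *: L (u *m A ^+ k) = 
      LL (u *m horner_mx A p).
    rewrite horner_mx_sum p_size mulmx_sumr linear_sum.
    by apply: eq_bigr => k _; rewrite -scalemxAr linearZ.
  rewrite Cayley_Hamilton mulmx0 raddf0.
  by have := iter_lin n.+1 (-1) 0 0; rewrite !scaleN1r !oppr0 addr0 addNr.
move: CH; rewrite big_ord_recr /= p_lead scale1r => /eqP.
rewrite addr_eq0 => /eqP CH.
(* The terms of degree below n retain at least one factor psi. *)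
have psi_low k u' : (k <= n)%N -> iter n.+1 psi (L (u' *m A ^+ k)) -
    iter (n.+1 - k) psi (L u') \in S.
  move=> kn; have -> : iter n.+1 psi (L (u' *m A ^+ k)) =
      iter (n.+1 - k) psi (iter k psi (L (u' *m A ^+ k))).
    by rewrite -iterD subnK // ltnW.
  have := iter_lin (n.+1 - k)%N (-1) (L u') (iter k psi (L (u' *m A ^+ k))).
  by rewrite !scaleN1r ![- _ + _]addrC => <-; exact/iterS/psiLk.
have psiLu k : iter k.+1 psi (L u) \in S.
  rewrite iterSr iterS // -(subrK (psi v) (psi (L u))) rpredD //.
  by rewrite -linearB; apply: psiS; rewrite submodBC.
have low : \sum_(k < n.+1) p`_k *: iter n.+1 psi (L (u *m A ^+ k)) \in S.
  apply: rpred_sum => k _; apply: rpredZ.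
  rewrite -(subrK (iter (n.+1 - k) psi (L u)) (iter _ _ _)).
  rewrite rpredD ?psi_low // -1?ltnS //.
  by rewrite subSn -1?ltnS.
move: (psiLk n.+1 u).
have top : iter n.+1 psi (L (u *m A ^+ n.+1)) \in S.
  by rewrite -[iter _ _ _]opprK submodN; move: low; rewrite CH.
move=> d.
by rewrite -(subKr (iter n.+1 psi (L (u *m A ^+ n.+1))) (L u)) submodB.
Qed.

(** Composing [f] with an isomorphism from [W] to [V] gives a surjective
    endomorphism of [V]; this is the case [S = 0] of the previous lemma. *)
Lemma fg_surj_endo_inj (R : comNzRingType) (V W : lmodType R)
    (f : {linear V -> W}) : finitely_generated V -> V ≃ W ->
  (forall w, exists v, f v = w) -> forall v, f v = 0 -> v = 0.
Proof.
move=> /finitely_generated_row[n [pi pi_surj]] [g [g' gK g'K]] f_surj v fv0.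
have [k [k' kK k'K]] := modiso_sym (ex_intro _ g (Bijective gK g'K)).
have /choice[s sP] w := f_surj w.
pose psi : {linear V -> V} := k \o f.
pose Z : {pred V} := fun u => u == 0.
have Z_submod : submod_closed Z.
  split; first exact: eqxx.
  by move=> a u w /eqP-> /eqP->; rewrite scaler0 addr0; exact: eqxx.
pose S : submodClosed V :=
  HB.pack Z (GRing.isSubmodClosed.Build R V Z Z_submod).
have inS u : (u \in S) = (u == 0) by [].
apply/eqP; rewrite -inS.
apply: (@surj_endo_inj_mod _ _ (fun=> True) S psi n
         (fun i => pi (delta_mx 0 i))) => //.
- move=> w _; have [u <-] := pi_surj w; exists (u 0).
  by rewrite inS {1}[u]row_sum_delta linear_sum subr_eq0;
    apply/eqP/eq_bigr => i _; rewrite linearZ.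
- by move=> w; rewrite !inS => /eqP->; rewrite raddf0.
- move=> w _; exists (s (k' w)) => //.
  by rewrite inS /= sP k'K subrr.
by rewrite inS /= fv0 raddf0.
Qed.

(** * Rank over the field of fractions *)

Section Rank.
Variable R : idomainType.
Implicit Types (M N : lmodType R).
Local Notation K := {fraction R}.
Local Notation tofrac := (@FracField.tofrac R).

Lemma tofrac_inj : injective tofrac.
Proof. by move=> a b /eqP; rewrite tofrac_eq => /eqP. Qed.

Lemma map_tofrac_inj m n :
  injective (map_mx tofrac : 'M[R]_(m, n) -> 'M[K]_(m, n)).
Proof.
move=> A B /matrixP AB; apply/matrixP => i j.
by have := AB i j; rewrite !mxE => /tofrac_inj.
Qed.

Lemma fraction_denom (x : K) :
  exists a b : R, b != 0 /\ tofrac b * x = tofrac a.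
Proof.
exists (repr x).1, (repr x).2; split; first exact: denom_ratioP.
rewrite -{2}[x]reprK; set r := repr x.
unlock FracField.tofrac; rewrite -[LHS]FracField.pi_mul.
apply/eqmodP; rewrite /= FracField.equivfE /FracField.mulf /=.
by rewrite !numden_Ratio ?mulf_neq0 ?oner_neq0 ?denom_ratioP //
  !mul1r mulr1 mulrC.
Qed.

Lemma row_denom n (w : 'rV[K]_n) :
  exists r (u : 'rV[R]_n), r != 0 /\ map_mx tofrac u = tofrac r *: w.
Proof.
have /choice[a /choice[b /all_and2[b0 ab]]] j := fraction_denom (w 0 j).
exists (\prod_j b j), (\row_j (a j * \prod_(k | k != j) b k)); split.
  exact/prodf_neq0.
apply/rowP => j; rewrite !mxE tofracM -ab [in RHS](bigD1 j) //= tofracM.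
by rewrite mulrAC.
Qed.

Definition torsion_elt N (u : N) : Prop := exists2 r : R, r != 0 & r *: u = 0.

Definition frac_linear N d (f : N -> 'rV[K]_d) : Prop :=
  forall r u v, f (r *: u + v) = tofrac r *: f u + f v.

(** Coordinates over the field of fractions identify [N] modulo torsion with a
    lattice spanning [K^d].  They witness [dim (N (x) K) = d] without mentioning
    the tensor product, and they commute with quotients by one element. *)
Definition frac_coords N d (f : N -> 'rV[K]_d) : Prop :=
  [/\ frac_linear f, forall u, f u = 0 <-> torsion_elt u &
      forall w, exists r u, r != 0 /\ f u = tofrac r *: w].

Definition has_rank N d : Prop := exists f : N -> 'rV[K]_d, frac_coords f.

Section FracLinear.
Variables (N : lmodType R) (d : nat) (f : N -> 'rV[K]_d).
Hypothesis fL : frac_linear f.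

Lemma frac_linear0 : f 0 = 0.
Proof.
by have := fL (-1) 0 0; rewrite scaler0 add0r rmorphN1 scaleN1r addNr.
Qed.

Lemma frac_linearD u v : f (u + v) = f u + f v.
Proof. by have := fL 1 u v; rewrite rmorph1 !scale1r. Qed.

Lemma frac_linearZ r u : f (r *: u) = tofrac r *: f u.
Proof. by have := fL r u 0; rewrite frac_linear0 !addr0. Qed.

Lemma frac_linearB u v : f (u - v) = f u - f v.
Proof.
by rewrite -scaleN1r frac_linearD frac_linearZ rmorphN1 scaleN1r.
Qed.

Lemma frac_linear_torsion u : torsion_elt u -> f u = 0.
Proof.
case=> r r0 ru; apply/eqP.
have : tofrac r *: f u == 0 by rewrite -frac_linearZ ru frac_linear0.
by rewrite scalemx_eq0 tofrac_eq0 (negPf r0).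
Qed.

End FracLinear.

(** An arbitrary set of row vectors has a finite basis of its span: a matrix of
    maximal rank with rows in the set. *)
Lemma max_rank_rows n (G : 'rV[K]_n -> Prop) :
  exists m (A : 'M[K]_(m, n)), (forall i, G (row i A)) /\
    forall v, G v -> (v <= A)%MS.
Proof.
pose P r := `[< exists m (A : 'M[K]_(m, n)),
  (forall i, G (row i A)) /\ \rank A = r >].
have P0 : exists r, P r.
  by exists 0%N; apply/asboolP; exists 0%N, 0; split; [case|rewrite mxrank0].
have Pn r : P r -> (r <= n)%N.
  by move=> /asboolP[m [A [_ <-]]]; exact: rank_leq_col.
case: (ex_maxnP P0 Pn) => r /asboolP[m [A [AG rA]]] rmax.
exists m, A; split=> // v Gv; apply/negPn/negP => vA.
have : P (\rank (col_mx A v)).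
  apply/asboolP; exists (m + 1)%N, (col_mx A v); split=> // i.
  case: (split_ordP i) => j ->; first by rewrite rowKu.
  by rewrite rowKd row_id.
move=> /rmax; rewrite leqNgt -rA => /negP; apply.
apply: rank_ltmx; rewrite ltmxE -!addsmxE addsmxSl /=.
by apply: contra vA; apply: submx_trans; exact: addsmxSr.
Qed.

Lemma mul_col_base_coker p m n (A : 'M[K]_(m, n)) (v : 'M_(p, n)) :
  v *m col_base (cokermx A) = 0 <-> (v <= A)%MS.
Proof.
have E : v *m cokermx A = v *m col_base (cokermx A) *m row_base (cokermx A).
  by rewrite -mulmxA mulmx_base.
by rewrite submxE E mulmx_free_eq0 ?row_base_free //; split=> /eqP.
Qed.

(** Write [N] as [R^n] modulo the kernel of [pi].  The span over [K] of that
    kernel is the row space of some [A], and the cokernel of [A] provides the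
    coordinates.  There may be infinitely many relations, but their span over
    [K] has a finite basis. *)
Lemma has_rank_exists N : finitely_generated N -> exists d, has_rank N d.
Proof.
move=> /finitely_generated_row[n [pi pi_surj]].
pose G (v : 'rV[K]_n) := exists2 u, pi u = 0 & v = map_mx tofrac u.
have [m [A [AG GA]]] := max_rank_rows G.
pose C := col_base (cokermx A); have [s sK] := choice pi_surj.
have mulC p (v : 'M_(p, n)) : v *m C = 0 <-> (v <= A)%MS.
  exact: mul_col_base_coker.
exists (\rank (cokermx A)), (fun v => map_mx tofrac (s v) *m C).
have fE u v : pi u = pi v -> map_mx tofrac u *m C = map_mx tofrac v *m C.
  move=> uv; apply/eqP; rewrite -subr_eq0 -mulmxBl -map_mxB.
  by apply/eqP/mulC/GA; exists (u - v); rewrite // linearB uv subrr.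
have fL : frac_linear (fun v => map_mx tofrac (s v) *m C).
  move=> r u v.
  rewrite (fE _ (r *: s u + s v)); last by rewrite linearP !sK.
  by rewrite map_mxD map_mxZ mulmxDl scalemxAl.
split=> // [u|w].
  split; last exact: (frac_linear_torsion fL).
  move=> /mulC/submxP[c uc].
  have [r [c' [r0 c'E]]] := row_denom c.
  have /choice[k /all_and2[pik kE]] i :
      exists u', pi u' = 0 /\ row i A = map_mx tofrac u'.
    by have [u'] := AG i; exists u'.
  exists r => //; rewrite -[u]sK -linearZ.
  have -> : r *: s u = \sum_i c' 0 i *: k i.
    apply: map_tofrac_inj; rewrite map_mxZ uc scalemxAl -c'E.
    rewrite mulmx_sum_row raddf_sum; apply: eq_bigr => i _ /=.
    by rewrite kE map_mxZ mxE.
  by rewrite linear_sum big1 // => i _; rewrite linearZ_LR pik scaler0.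
have /row_fullP[B BC] : row_full C by exact: col_base_full.
have [r [u [r0 uE]]] := row_denom (w *m B).
exists r, (pi u); split=> //; rewrite (fE _ u) ?sK // uE.
by rewrite -scalemxAl -mulmxA BC mulmx1.
Qed.

Section RankQuotient.
Variables (N M : lmodType R) (x : N) (p : {linear N -> M}).
Hypothesis px : quotient_by x p.

Lemma has_rank_quotient_torsion d :
  torsion_elt x -> has_rank N d -> has_rank M d.
Proof.
move=> x_tor [f [fL f0 f_span]]; have [/choice[s sK] p0] := px.
have fx r : f (r *: x) = 0.
  by rewrite frac_linearZ // (frac_linear_torsion fL x_tor) scaler0.
have fE u v : p u = p v -> f u = f v.
  move=> /eqP; rewrite -subr_eq0 -linearB => /eqP/p0[r uv].
  by apply/eqP; rewrite -subr_eq0 -frac_linearB // uv fx.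
exists (f \o s); have L : frac_linear (f \o s).
  by move=> r u v /=; rewrite -fL; apply: fE; rewrite linearP !sK.
split=> // [u|w].
  split; last exact: (frac_linear_torsion L).
  move=> /f0[r r0 ru]; exists r => //.
  by rewrite -[u]sK -linearZ ru linear0.
have [r [u [r0 fu]]] := f_span w; exists r, (p u); split=> //=.
by rewrite (fE _ u) ?sK.
Qed.

(** Projecting [K^d] along the nonzero vector [f x] gives coordinates on the
    quotient. *)
Lemma has_rank_quotient d : ~ torsion_elt x -> has_rank N d ->
  (0 < d)%N /\ has_rank M d.-1.
Proof.
move=> x_tor [f [fL f0 f_span]]; have [/choice[s sK] p0] := px.
have fx0 : f x != 0 by apply/eqP => /f0.
pose C := col_base (cokermx (f x)).
have mulC (v : 'rV_d) : v *m C = 0 <-> (v <= f x)%MS.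
  exact: mul_col_base_coker.
have rC : \rank (cokermx (f x)) = d.-1.
  by rewrite mxrank_coker rank_rV fx0 subn1.
have fE u v : p u = p v -> f u *m C = f v *m C.
  move=> /eqP; rewrite -subr_eq0 -linearB => /eqP/p0[r uv].
  apply/eqP; rewrite -subr_eq0 -mulmxBl -frac_linearB // uv frac_linearZ //.
  by apply/eqP/mulC/scalemx_sub.
split; first by have := rank_leq_col (f x); rewrite rank_rV fx0.
rewrite -rC; exists (fun v => f (s v) *m C).
have L : frac_linear (fun v => f (s v) *m C).
  move=> r u v; rewrite (fE _ (r *: s u + s v)); last by rewrite linearP !sK.
  by rewrite fL mulmxDl scalemxAl.
split=> // [u|w].
  split; last exact: (frac_linear_torsion L).
  move=> /mulC/sub_rVP[c fc]; have [a [b [b0 ab]]] := fraction_denom c.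
  have : f (b *: s u - a *: x) = 0.
    by rewrite frac_linearB // !frac_linearZ // fc scalerA ab subrr.
  move=> /f0[r r0]; rewrite scalerBr => /eqP; rewrite subr_eq0 => /eqP ru.
  exists (r * b); first by rewrite mulf_neq0.
  rewrite -[u]sK -linearZ -scalerA ru; apply/p0.
  by exists (r * a); rewrite scalerA.
have /row_fullP[B BC] : row_full C by exact: col_base_full.
have [r [u [r0 fu]]] := f_span (w *m B).
exists r, (p u); split=> //; rewrite (fE _ u) ?sK // fu.
by rewrite -scalemxAl -mulmxA BC mulmx1.
Qed.

End RankQuotient.

Lemma has_rank_iso M N d : M ≃ N -> has_rank M d -> has_rank N d.
Proof.
move=> /modiso_sym[g [g' gK g'K]] [f [fL f0 f_span]]; exists (f \o g).
split=> [r u v|u|w] /=; first by rewrite linearP fL.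
  rewrite f0; split=> -[r r0 ru]; exists r => //; last first.
    by rewrite -linearZ ru linear0.
  rewrite -linearZ in ru.
  by rewrite -[r *: u]gK ru -(linear0 g) gK.
have [r [u [r0 fu]]] := f_span w.
by exists r, (g' u); rewrite g'K.
Qed.

Lemma has_rank0 N : (forall u : N, u = 0) -> has_rank N 0.
Proof.
move=> N0; exists (fun=> 0); split=> [r u v|u|w].
- by rewrite scaler0 addr0.
- split=> // _; exists 1; first exact: oner_neq0.
  by rewrite [u]N0 scaler0.
by exists 1, 0; rewrite oner_neq0 [w]thinmx0 scaler0.
Qed.

Lemma has_rank0_torsion N : has_rank N 0 -> forall u : N, torsion_elt u.
Proof. by move=> [f [_ f0 _]] u; apply/f0; rewrite [f u]thinmx0. Qed.

(** This is what is used of the injectivity of [K] as an [R]-module. *)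
Lemma frac_functional N (x : N) : finitely_generated N -> ~ torsion_elt x ->
  exists g : {linear N -> fracmod R}, g x = (1 : K).
Proof.
move=> /has_rank_exists[d [f [fL f0 _]]] x_tor.
have : f x != 0 by apply/eqP => /f0.
move=> /rV0Pn[j fxj].
have gL : linear (fun u => (f u 0 j / f x 0 j : fracmod R)).
  move=> r u v; rewrite fL !mxE mulrDl -mulrA; exact: erefl.
by have [g gE] := linear_fun gL; exists g; rewrite gE divff.
Qed.

End Rank.

(** * Rank and tensor product *)

Section FreeModule.
Import monalg.
Variables (K : nzRingType) (I : choiceType) (V : lmodType K) (G : I -> V).

Lemma malg_extension :
  exists F : {linear {malg K[I]} -> V}, forall i, F << i >> = G i.
Proof.
pose F (m : {malg K[I]}) := \sum_(i <- msupp m) mcoeff i m *: G i.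
have FE (m : {malg K[I]}) (D : {fset I}) : (msupp m `<=` D)%fset ->
    F m = \sum_(i <- D) mcoeff i m *: G i.
  move=> mD; apply: big_fset_incl => // i _ im.
  by rewrite mcoeff_outdom ?scale0r.
have FL : linear F.
  move=> a m m'.
  have mD : (msupp m `<=` msupp m `|` msupp m')%fset by apply: fsubsetUl.
  have mD' : (msupp m' `<=` msupp m `|` msupp m')%fset by apply: fsubsetUr.
  rewrite (FE _ _ mD) (FE _ _ mD').
  rewrite (FE (a *: m + m') (msupp m `|` msupp m')%fset).
    rewrite scaler_sumr -big_split; apply: eq_bigr => i _ /=.
    by rewrite mcoeffD mcoeffZ scalerDl scalerA.
  apply: fsubset_trans (msuppD_le _ _) _.
  by apply: fsetSU; exact: msuppZ_le.
have [F' F'E] := linear_fun FL; exists F' => i; rewrite F'E.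
by rewrite /F msuppU oner_eq0 big_seq_fset1 mcoeffUU scale1r.
Qed.

End FreeModule.

Section TensorRank.
Import monalg.
Variables (R : idomainType) (N : lmodType R).
Local Notation K := {fraction R}.
Local Notation tofrac := (@FracField.tofrac R).

Definition tens (u : N) (q : K) : tensor_frac N :=
  modproj (lspan (@tensor_rel R N)) << (u, q) >>.

Lemma tensor_relP (m m' : {malg K[(N * K)%type]}) : tensor_rel (m - m') ->
  modproj (lspan (@tensor_rel R N)) m = modproj (lspan (@tensor_rel R N)) m'.
Proof. by move=> mm'; apply/eqP; rewrite modproj_eq; exact: mem_lspan. Qed.

Lemma tensDl u v q : tens (u + v) q = tens u q + tens v q.
Proof.
rewrite /tens -linearD; apply: tensor_relP; rewrite opprD addrA.
exact: tensor_addl.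
Qed.

Lemma tens_bal r u q : tens (r *: u) q = tens u (tofrac r * q).
Proof. apply: tensor_relP; exact: tensor_bal. Qed.

Lemma tens_act c u q : tens u (c * q) = c *: tens u q.
Proof. rewrite /tens -linearZ; apply: tensor_relP; exact: tensor_act. Qed.

Lemma tens0 q : tens 0 q = 0.
Proof.
by rewrite -(scale0r 0) tens_bal tofrac0 mul0r -(mul0r 0) tens_act scale0r.
Qed.

Lemma tensDenom s r u : s != 0 ->
  tens u (tofrac r)^-1 = tens (s *: u) (tofrac (s * r))^-1.
Proof.
move=> s0; rewrite tens_bal tofracM invfM mulrA divff ?mul1r //.
by rewrite tofrac_eq0.
Qed.

(** A common denominator reduces every tensor to a pure one [u (x) 1/r]. *)
Lemma tensP (t : tensor_frac N) :
  exists u r, r != 0 /\ t = tens u (tofrac r)^-1.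
Proof.
have [m ->] := modproj_surj t; rewrite [m]monalgE linear_sum.
apply: (big_ind (fun t => exists u (r : R),
    r != 0 /\ t = tens u (tofrac r)^-1)) =>
  [|x y [u [r [r0 ->]]] [v [s [s0 ->]]]|[u q] _].
- by exists 0, 1; rewrite oner_neq0 tens0.
- exists (s *: u + r *: v), (s * r); rewrite mulf_neq0 //.
  by rewrite tensDl (tensDenom r u s0) (tensDenom s v r0) [r * s]mulrC.
have [a [b [b0 ab]]] := fraction_denom (mcoeff (u, q) m * q).
exists (a *: u), b; split; first exact: b0.
rewrite tens_bal -ab mulrAC divff; last by rewrite tofrac_eq0.
rewrite mul1r tens_act /tens -linearZ; congr (modproj _ _).
apply/malgP => k; rewrite mcoeffZ !mcoeffU.
by case: eqP => _; rewrite ?mulr1n ?mulr1 // !mulr0n mulr0.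
Qed.

Lemma has_rank_vdim d : has_rank N d -> vdim (tensor_frac N) = d.
Proof.
move=> [f [fL f0 f_span]]; apply: vdim_eq; apply: modiso_sym.
pose G (k : N * K) := k.2 *: f k.1.
have [F FE] := malg_extension G.
have [g gE] : exists g : {linear tensor_frac N -> 'rV[K]_d},
    forall m, g (modproj _ m) = F m.
  apply: linear_factor => [t|m].
    by have [m ->] := modproj_surj t; exists m.
  move/eqP; rewrite -[X in _ == X](linear0 (modproj _)) modproj_eq subr0.
  move=> /lspanP[n [c [h [hG ->]]]]; rewrite linear_sum big1 // => i _.
  have FB2 k k' : F (<< k >> - << k' >>) = G k - G k'.
    by rewrite linearB; congr (_ - _); exact: FE.
  have FB3 k k' k'' : F (<< k >> - << k' >> - << k'' >>) = G k - G k' - G k''.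
    by rewrite 2!linearB; congr (_ - _ - _); exact: FE.
  have FBZ a k k' : F (<< k >> - a *: << k' >>) = G k - a *: G k'.
    by rewrite linearB linearZ; congr (_ - _ *: _); exact: FE.
  rewrite linearZ_LR; suff -> : F (h i) = 0 by rewrite scaler0.
  case: (hG i) => [u u' q|u q q'|r u q|a u q].
  - by rewrite FB3 /G /= frac_linearD // scalerDr -addrA -opprD subrr.
  - by rewrite FB3 /G /= scalerDl -addrA -opprD subrr.
  - by rewrite FB2 /G /= frac_linearZ // scalerA [q * _]mulrC subrr.
  by rewrite FBZ /G /= scalerA subrr.
have gt u q : g (tens u q) = q *: f u by rewrite gE; exact: FE.
apply: (quotient_bij (f := g)) => [w|t].
  have [r [u [r0 fu]]] := f_span w; exists (tens u (tofrac r)^-1).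
  by rewrite gt fu scalerA mulVf ?scale1r // tofrac_eq0.
have [u [r [r0 ->]]] := tensP t; rewrite gt => /eqP.
rewrite scalemx_eq0 invr_eq0 tofrac_eq0 (negPf r0) => /eqP/f0[s s0 su].
by rewrite (tensDenom _ _ s0) su tens0.
Qed.

End TensorRank.

(** * Splitting a free summand by means of Ext *)

Section Ext.
Variable R : idomainType.
Implicit Types (M N P Q : lmodType R).
Local Notation K := (fracmod R).
Local Notation KR := (modquot (@integral_pred R)).
Local Notation pi := (modproj (@integral_pred R)).
Local Notation tofrac := (@FracField.tofrac R).

Lemma fracmodZ r (q : K) :
  r *: q = tofrac r * (q : {fraction R}) :> {fraction R}.
Proof. by []. Qed.

Lemma pi_eq0 (q : K) : pi q = 0 <-> exists r : R, q = tofrac r.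
Proof.
rewrite -(linear0 pi); split=> [/eqP|[r qr]]; last apply/eqP.
  by rewrite modproj_eq subr0 => /asboolP.
by rewrite modproj_eq subr0; apply/asboolP; exists r.
Qed.

Lemma integral_functional N (g : {linear N -> K}) : (forall u, pi (g u) = 0) ->
  exists phi : {linear N -> R^o},
    forall u, g u = tofrac (phi u) :> {fraction R}.
Proof.
move=> g0; have /choice[phi phiE] u := proj1 (pi_eq0 _) (g0 u).
have phiL : linear (phi : N -> R^o).
  move=> a u v; apply: (@tofrac_inj R).
  change (tofrac (phi (a *: u + v)) = tofrac (a * phi u + phi v)).
  by rewrite tofracD tofracM -!phiE linearP.
by have [phi' phi'E] := linear_fun phiL; exists phi' => u; rewrite phi'E -phiE.
Qed.

Lemma scalar_map_linear N (g : {linear N -> K}) (q : K) :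
  linear (fun u => (q : {fraction R}) * (g u : {fraction R}) : K).
Proof.
move=> r u v; rewrite linearP [LHS]mulrDr; congr (_ + _).
by rewrite [in LHS]fracmodZ [RHS]fracmodZ mulrCA.
Qed.

(** The sequence [0 -> R -> K -> K/R -> 0], with [K] injective, presents
    [Ext^1 (N, R)] as the maps from [N] to [K/R] modulo those that lift to [K].
    The definition says that this module is finitely generated. *)
Definition ext_fg N : Prop :=
  exists k (h : 'I_k -> {linear N -> KR}), forall h0 : {linear N -> KR},
    exists (c : 'I_k -> R) (g : {linear N -> K}),
      forall u, h0 u = \sum_j c j *: h j u + pi (g u).

(** A torsion module has no nonzero map to [K], so its [Ext^1] is its dual. *)
Lemma ext_fg_torsion N : (forall u : N, torsion_elt u) ->
  finitely_generated (dual (torsion N)) -> ext_fg N.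
Proof.
move=> N_tor /finitely_generated_row[k [f f_surj]].
have tP u : u \in (@torsion_pred R N) by apply/asboolP/N_tor.
pose t u : torsion N := Submod (tP u).
have hL j : linear (fun u => \val (f (delta_mx 0 j)) (t u)).
  move=> a u v; have /asboolP L := valP (f (delta_mx 0 j)).
  by rewrite -L; congr (\val _ _); exact: val_inj.
have /choice[h hE] j := linear_fun (hL j).
exists k, h => h0.
have h0L : (fun u : torsion N => h0 (\val u)) \in @linear_pred R (torsion N) KR.
  by apply/asboolP => a u v; rewrite linearP.
have [c cE] := f_surj (Submod h0L).
exists (c 0), (\0 : {linear N -> K}) => u.
rewrite linear0 addr0.
have -> : h0 u = \val (f c) (t u) by rewrite cE.
rewrite {1}[c]row_sum_delta linear_sum raddf_sum fct_sumE.
by apply: eq_bigr => j _; rewrite hE !linearZ_LR.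
Qed.

(** When [x] is not torsion, [R x] is free, so [Ext^1 (N/x, R)] maps onto
    [Ext^1 (N, R)].  Concretely, subtracting a multiple of a functional with
    value 1 at [x] makes a map to [K/R] vanish on [x]. *)
Lemma ext_fg_quotient N M (x : N) (p : {linear N -> M}) :
    quotient_by x p -> finitely_generated N -> ~ torsion_elt x ->
  ext_fg M -> ext_fg N.
Proof.
move=> [p_surj p0] N_fg x_tor [k [h hP]].
have [g0 g0x] := frac_functional N_fg x_tor.
exists k, (fun j => h j \o p) => h0.
have [q qx] := modproj_surj (h0 x).
have [qg qgE] := linear_fun (scalar_map_linear g0 q).
have [h1 h1E] : exists h1 : {linear M -> KR}, forall u,
    h1 (p u) = h0 u - pi (qg u).
  have L : linear (fun u => h0 u - pi (qg u)).
    move=> a u v; rewrite [h0 _]linearP [qg _]linearP [pi _]linearP.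
    rewrite opprD addrACA; congr (_ + _).
    by rewrite -scalerBr.
  have [h0' h0'E] := linear_fun L.
  have [|h1 h1E] := linear_factor (h := h0') p_surj.
    move=> u /p0[r ->]; rewrite h0'E.
    have -> : h0 (r *: x) = pi (qg (r *: x)).
      rewrite linearZ qx !linearZ; congr (_ *: pi _).
      by rewrite qgE g0x [RHS]mulr1.
    by rewrite subrr.
  by exists h1 => u; rewrite h1E h0'E.
have [c [g gE]] := hP h1.
exists c, ((g \o p) \+ qg) => u /=.
by rewrite linearD addrA -gE h1E subrK.
Qed.

Section FunctionModule.
Variable Q : lmodType R.

Definition lifts_to_frac : {pred Q -> KR} :=
  fun h => `[< exists g : {linear Q -> K}, forall u, h u = pi (g u) >].

Lemma lifts_to_frac_submod : submod_closed lifts_to_frac.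
Proof.
split.
  by apply/asboolP; exists (\0 : {linear Q -> K}) => u; rewrite linear0.
move=> a h h' /asboolP[g gE] /asboolP[g' g'E]; apply/asboolP.
exists ((a \*: g) \+ g') => u.
by rewrite -[LHS]/(a *: h u + h' u) gE g'E -linearP.
Qed.

HB.instance Definition _ :=
  GRing.isSubmodClosed.Build R (Q -> KR) lifts_to_frac lifts_to_frac_submod.

Lemma precomp_linear (k : Q -> Q) : linear (fun h : Q -> KR => h \o k).
Proof. by []. Qed.

End FunctionModule.

(** A form of Miyata's theorem in which finite generation of [Ext^1 (Q, R)]
    replaces the noetherian hypothesis: if [0 -> R y -> P -> Q -> 0] is exact
    and [P] is isomorphic to [Q (+) R], then [y] spans a direct summand.  Since
    [y] is not torsion, [Ext^1 (Q, R) -> Ext^1 (P, R)] is onto; its target is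
    again [Ext^1 (Q, R)], so it is injective.  A functional [e] from [P] to [K]
    with [e y = 1] induces a map from [Q] to [K/R], which is the class of the
    extension.  In [Ext^1 (P, R)] this class is 0, with [e] as a lift, so it
    already lifts to some [f] from [Q] to [K], and [e - f o g] is the desired
    functional. *)
Lemma split_of_iso P Q (y : P) (g : {linear P -> Q}) :
    quotient_by y g -> P ≃ (Q * R^o)%type -> finitely_generated P ->
    ~ torsion_elt y -> ext_fg Q ->
  exists phi : {linear P -> R^o}, phi y = 1.
Proof.
move=> [g_surj g0] /modiso_sym[alpha [alpha' alphaK alpha'K]] P_fg y_tor.
move=> [n [h hP]].
have [e ey] := frac_functional P_fg y_tor.
have inclL : linear (fun q => alpha (q, 0)).
  move=> a u v; rewrite -linearP; congr (alpha _).
  by rewrite -[RHS]/(a *: u + v, a *: (0 : R^o) + 0) scaler0 addr0.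
have [incl inclE] := linear_fun inclL.
pose k : Q -> Q := g \o incl.
have [psi psiE] := linear_fun (precomp_linear k).
have [gy gyE] : exists gy : {linear Q -> KR}, forall u, gy (g u) = pi (e u).
  apply: (linear_factor (h := pi \o e)) => // u /g0[r ->] /=.
  apply/pi_eq0; exists r; rewrite linearZ ey; exact: mulr1.
have lift : (gy : Q -> KR) \in @lifts_to_frac Q.
  apply: (@surj_endo_inj_mod _ _ (fun h => linear h)
    (@lifts_to_frac Q : submodClosed _) psi n (fun i => h i : Q -> KR)).
  - by move=> i a u v; rewrite linearP.
  - move=> v vL; have [v' v'E] := linear_fun vL.
    have [c [f fE]] := hP v'; exists c; apply/asboolP; exists f => u.
    have -> : (v - \sum_i c i *: (h i : Q -> KR)) u =
        v u - \sum_i c i *: h i u.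
      by rewrite -[LHS]/(v u - (\sum_i c i *: (h i : Q -> KR)) u) fct_sumE.
    by rewrite -v'E fE addrC addKr.
  - move=> v /asboolP[f fE]; apply/asboolP.
    exists (f \o (g \o incl)) => u; by rewrite psiE /= fE.
  - move=> v vL.
    (* Extend v by 0 along the summand R, then correct it by a multiple of e
       so that it vanishes at y and descends to Q. *)
    have wL : linear (fun u => v (alpha' u).1).
      move=> a u u'; rewrite -vL; congr (v _).
      have -> : alpha' (a *: u + u') = a *: alpha' u + alpha' u'.
        by apply: (can_inj alphaK); rewrite linearP !alpha'K.
      by [].
    have [w wE] := linear_fun wL.
    have [q qy] := modproj_surj (w y).
    have [qe qeE] := linear_fun (scalar_map_linear e q).
    have L : linear (fun u => w u - pi (qe u)).
      move=> a u u'; rewrite [w _]linearP [qe _]linearP [pi _]linearP.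
      rewrite opprD addrACA; congr (_ + _).
      by rewrite -scalerBr.
    have [w' w'E] := linear_fun L.
    have [|v2 v2E] := linear_factor (h := w') g_surj.
      move=> u /g0[r ->]; rewrite w'E.
      have -> : w (r *: y) = pi (qe (r *: y)).
        rewrite linearZ qy !linearZ; congr (_ *: pi _).
        by rewrite qeE ey [RHS]mulr1.
      by rewrite subrr.
    exists (v2 : Q -> KR); first by move=> a u u'; rewrite linearP.
    apply/asboolP; exists (\- (qe \o incl)) => u.
    rewrite -[LHS]/(psi v2 u - v u) psiE /= v2E w'E wE inclE alphaK /=.
    by rewrite addrAC subrr add0r linearN.
  - by move=> a u v; rewrite linearP.
  apply/asboolP; exists (e \o incl) => u.
  by rewrite psiE /= gyE.
case/asboolP: lift => f fE.
have [|phi phiE] := @integral_functional P (e \- (f \o g)).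
  by move=> u /=; rewrite [pi _]linearB /= -fE gyE subrr.
exists phi; apply: (@tofrac_inj R); rewrite -phiE /= ey.
have -> : g y = 0 by apply/g0; exists 1; rewrite scale1r.
by rewrite linear0 subr0 tofrac1.
Qed.

End Ext.

(** * Torsion classes and ranks in a matroid over a domain *)

Section TorsionClass.
Variable R : idomainType.
Implicit Types U V : lmodType R.

Lemma torsion_iso U V (f : {linear U -> V}) :
    (forall u, torsion_elt u -> f u = 0 -> u = 0) ->
    (forall v, torsion_elt v -> exists2 u, torsion_elt u & f u = v) ->
  torsion U ≃ torsion V.
Proof.
move=> f_inj f_surj.
have fP (u : torsion U) : f (\val u) \in @torsion_pred R V.
  have /asboolP[r r0 ru] := valP u; apply/asboolP; exists r => //.
  by rewrite -linearZ ru linear0.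
have L : linear (fun u : torsion U => Submod (fP u) : torsion V).
  by move=> a u v; apply: val_inj; rewrite /= linearP.
have [g gE] := linear_fun L; apply: (quotient_bij (f := g)) => [v|u].
  have /asboolP/f_surj[u u_tor fu] := valP v.
  have uP : u \in @torsion_pred R U by apply/asboolP.
  by exists (Submod uP); rewrite gE; apply: val_inj.
rewrite gE => /(congr1 val) /= fu0; apply: val_inj => /=.
by apply: f_inj => //; apply/asboolP/(valP u).
Qed.

Lemma torsion_modiso U V : U ≃ V -> torsion U ≃ torsion V.
Proof.
case=> f [g fK gK]; apply: (@torsion_iso _ _ f) => [u _ fu0|v [r r0 rv]].
  by rewrite -[u]fK fu0 -(linear0 f) fK.
exists (g v); last exact: gK.
by exists r => //; apply: (can_inj fK); rewrite linearZ_LR gK rv linear0.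
Qed.

Lemma torsion_prod_regular U : torsion (U * R^o)%type ≃ torsion U.
Proof.
have fL : linear (fun p : (U * R^o)%type => p.1) by [].
have [f fE] := linear_fun fL; apply: (@torsion_iso _ _ f) => [[u s]|u].
  case=> r r0 /(congr1 snd) /= /eqP; rewrite mulf_eq0 (negPf r0) /= => /eqP ->.
  by rewrite fE /= => ->.
case=> r r0 ru; exists (u, 0); last by rewrite fE.
by exists r => //; congr pair; rewrite ?ru // scaler0.
Qed.

Lemma dual_modiso U V : U ≃ V -> dual U ≃ dual V.
Proof.
case=> f [g fK gK].
have [||g' g'K] := linear_factor (f := f) (h := idfun).
- by move=> v; exists (g v).
- by move=> u /= fu0; rewrite -[u]fK fu0 -(linear0 f) fK.
have fg' v : f (g' v) = v by rewrite -[v]gK g'K.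
have pP (h : dual U) :
    (\val h \o g') \in @linear_pred R V (modquot (@integral_pred R)).
  by apply/asboolP => a u v /=; have /asboolP L := valP h; rewrite linearP L.
have qP (h : dual V) :
    (\val h \o f) \in @linear_pred R U (modquot (@integral_pred R)).
  by apply/asboolP => a u v /=; have /asboolP L := valP h; rewrite linearP L.
have L : linear (fun h : dual U => Submod (pP h) : dual V).
  by move=> a h h'; apply: val_inj.
have [F FE] := linear_fun L; exists F.
exists (fun h : dual V => Submod (qP h) : dual U) => h; rewrite ?FE;
  apply: val_inj; apply/funext => u /=.
  by rewrite /= g'K.
by rewrite fg'.
Qed.

Lemma L0cls_modiso U V : U ≃ V -> L0cls U = L0cls V.
Proof.
move=> UV; rewrite /L0cls.
case: pselect => [Ufg|UNfg]; case: pselect => [Vfg|VNfg] //.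
- exact: L0class_eq.
- by case: VNfg; exact: fg_iso Ufg.
by case: UNfg; apply: fg_iso Vfg; exact: modiso_sym.
Qed.

Lemma L0cls_dual_torsion U V : U ≃ V ->
  L0cls (dual (torsion U)) = L0cls (dual (torsion V)).
Proof. by move=> UV; exact/L0cls_modiso/dual_modiso/torsion_modiso. Qed.

Lemma L0cls_dual_torsion_prod_regular U :
  L0cls (dual (torsion (U * R^o)%type)) = L0cls (dual (torsion U)).
Proof. exact/L0cls_modiso/dual_modiso/torsion_prod_regular. Qed.

End TorsionClass.

Section QuotientMaps.

(** The isomorphism theorem [N/(x, y) = (N/x)/y] in terms of surjections. *)
Lemma quotient_by2_factor (R : nzRingType) (N P Q : lmodType R) (x y : N)
    (f : {linear N -> P}) (h : {linear N -> Q}) :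
    quotient_by x f -> quotient_by2 x y h ->
  exists2 g : {linear P -> Q}, quotient_by (f y) g & forall u, g (f u) = h u.
Proof.
move=> [f_surj f0] [h_surj h0].
have [u /f0[r ->]|g gE] := linear_factor (h := h) f_surj.
  by apply/h0; exists r, 0; rewrite scale0r addr0.
exists g => //; split=> [q|p].
  by have [u <-] := h_surj q; exists (f u).
have fx : f x = 0 by apply/f0; exists 1; rewrite scale1r.
have [u <-] := f_surj p; rewrite gE; split=> [/h0[r [s ->]]|[s us]].
  by exists s; rewrite linearD !linearZ_LR fx scaler0 add0r.
have /f0[r ur] : f (u - s *: y) = 0.
  by rewrite linearB linearZ_LR us subrr.
by apply/h0; exists r, s; rewrite -ur subrK.
Qed.

Lemma split_quotient (R : nzRingType) (N Q : lmodType R) (y : N)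
    (g : {linear N -> Q}) (phi : {linear N -> R^o}) :
  quotient_by y g -> phi y = 1 -> N ≃ (Q * R^o)%type.
Proof.
move=> [g_surj g0] phiy.
have gy : g y = 0 by apply/g0; exists 1; rewrite scale1r.
have L : linear (fun u => (g u, phi u) : (Q * R^o)%type).
  by move=> a u v; rewrite !linearP.
have [F FE] := linear_fun L; apply: (quotient_bij (f := F)) => [[q r]|u].
  have [u <-] := g_surj q; exists (u + (r - phi u) *: y).
  rewrite FE !linearD !linearZ_LR gy phiy scaler0 addr0; congr pair.
  by rewrite [_ *: _]mulr1 addrC subrK.
rewrite FE => -[/g0[s ->]].
by rewrite linearZ_LR phiy [_ *: _]mulr1 => ->; rewrite scale0r.
Qed.

End QuotientMaps.

Section MatroidRank.
Variables (R : idomainType) (E : finType) (M : Rmatroid R E).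
Implicit Types (A B : {set E}) (b c i : E).

Lemma rmatroid_step2 A b c : b \notin A -> c \notin A ->
  exists (x y : M A) (f : {linear M A -> M (A :|: [set b])})
    (g : {linear M A -> M (A :|: [set c])})
    (h : {linear M A -> M (A :|: [set b; c])}),
    [/\ quotient_by x f, quotient_by y g & quotient_by2 x y h].
Proof.
move=> bA cA; have [x [y [bx cy bcxy]]] := rmatP M bA cA.
have [f f_surj f0] := modiso_quotient bx.
have [g g_surj g0] := modiso_quotient cy.
have [h h_surj h0] := modiso_quotient bcxy.
exists x, y, f, g, h; split; split=> // u; [rewrite f0|rewrite g0|rewrite h0].
- exact: lspan1.
- exact: lspan1.
exact: lspan2.
Qed.

Lemma rmatroid_step A b : b \notin A ->
  exists (x : M A) (f : {linear M A -> M (A :|: [set b])}), quotient_by x f.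
Proof.
move=> bA; have [x [_ [f [_ [_ [xf _ _]]]]]] := rmatroid_step2 bA bA.
by exists x, f.
Qed.

Definition frac_rank A := vdim (tensor_frac (M A)).

Lemma frac_rankP A : has_rank (M A) (frac_rank A).
Proof.
have [d dA] := has_rank_exists (fgmodP (M A)).
by rewrite /frac_rank (has_rank_vdim dA).
Qed.

Lemma has_rank_frac_rank A d : has_rank (M A) d -> frac_rank A = d.
Proof. exact: has_rank_vdim. Qed.

Lemma rkE A : rk M A = (frac_rank finset.set0 - frac_rank A)%N.
Proof. by []. Qed.

Lemma frac_rank_torsion A b (x : M A) (f : {linear M A -> M (A :|: [set b])}) :
  quotient_by x f -> torsion_elt x -> frac_rank (A :|: [set b]) = frac_rank A.
Proof.
move=> xf x_tor.
by apply/has_rank_frac_rank/(has_rank_quotient_torsion xf)/frac_rankP.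
Qed.

Lemma frac_rank_nontorsion A b (x : M A)
    (f : {linear M A -> M (A :|: [set b])}) :
  quotient_by x f -> ~ torsion_elt x ->
  frac_rank A = (frac_rank (A :|: [set b])).+1.
Proof.
move=> xf x_tor; have [d_gt0 d1] := has_rank_quotient xf x_tor (frac_rankP A).
by rewrite (has_rank_frac_rank d1) prednK.
Qed.

Lemma frac_rank_step A b : b \notin A ->
  frac_rank A = frac_rank (A :|: [set b]) \/
  frac_rank A = (frac_rank (A :|: [set b])).+1.
Proof.
move=> bA; have [x [f xf]] := rmatroid_step bA.
have [x_tor|x_tor] := pselect (torsion_elt x).
  by left; rewrite (frac_rank_torsion xf).
by right; exact: frac_rank_nontorsion xf x_tor.
Qed.

Lemma set_ind_up (P : {set E} -> Prop) A : P A ->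
    (forall B b, A \subset B -> b \notin B -> P B -> P (B :|: [set b])) ->
  forall B, A \subset B -> P B.
Proof.
move=> PA PS B; have [n] := ubnP #|B|; elim: n => // n IHn in B *.
move=> Bn AB; have [<- //|AnB] := eqVneq A B.
have /properP[_ [b bB bA]] : A \proper B by rewrite properEneq AnB.
rewrite -(finset.setD1K bB) finset.setUC; apply: PS.
- by rewrite subsetD1 AB.
- by rewrite !inE eqxx.
apply: IHn; last by rewrite subsetD1 AB.
by rewrite (cardsD1 b) bB in Bn.
Qed.

Lemma set_ind_down (P : {set E} -> Prop) :
  (forall A, (forall b, b \notin A -> P (A :|: [set b])) -> P A) ->
  forall A, P A.
Proof.
move=> PS A; have [n] := ubnP #|~: A|; elim: n => // n IHn in A *.
move=> An; apply: PS => b bA; apply: IHn.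
have : #|~: (A :|: [set b])|.+1 = #|~: A|.
  rewrite [RHS](cardsD1 b) inE bA add1n; congr _.+1; apply: eq_card => j.
  by rewrite !inE negb_or andbC.
by move=> Ab; rewrite -Ab in An.
Qed.

Lemma frac_rank_anti A B : A \subset B -> (frac_rank B <= frac_rank A)%N.
Proof.
move=> AB.
apply: (set_ind_up (P := fun B => (frac_rank B <= frac_rank A)%N) _ _ AB) => //.
move=> C b _ bC; case: (frac_rank_step bC) => -> //; exact: leq_trans.
Qed.

Lemma rk_le_card A : (rk M A <= #|A|)%N.
Proof.
rewrite rkE leq_subLR; apply: (set_ind_up (P := fun A =>
  (frac_rank finset.set0 <= frac_rank A + #|A|)%N) _ _ (finset.sub0set A)).
  by rewrite cards0 addn0.
move=> B b _ bB le.
have -> : #|B :|: [set b]| = #|B|.+1 by rewrite finset.setUC cardsU1 bB.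
case: (frac_rank_step bB); lia.
Qed.

(** If no single element lowers the rank, no set of elements does: if [b] and
    [c] are added by dividing out [x] and [y], and [y] is torsion, then so is
    its image modulo [x]. *)
Lemma frac_rank_loops A : (forall b, b \notin A ->
    frac_rank (A :|: [set b]) = frac_rank A) ->
  frac_rank [set: E] = frac_rank A.
Proof.
move=> A_loops.
pose P B := frac_rank B = frac_rank A /\ forall c, c \notin B ->
  frac_rank (B :|: [set c]) = frac_rank B.
suff [] : P [set: E] by [].
apply: (set_ind_up (A := A)); rewrite ?finset.subsetT //.
move=> B b _ bB [BA B_loops].
split=> [|c]; first by rewrite B_loops.
rewrite !inE negb_or => /andP[cB cb].
have [x [y [f [g [h [xf yg xyh]]]]]] := rmatroid_step2 bB cB.
have y_tor : torsion_elt y.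
  have [//|y_tor] := pselect (torsion_elt y).
  by have := frac_rank_nontorsion yg y_tor; rewrite B_loops // => /eqP;
    rewrite -[X in X == _]addn0 -addn1 eqn_add2l.
have [k yk _] := quotient_by2_factor xf xyh.
have fy_tor : torsion_elt (f y).
  by case: y_tor => r r0 ry; exists r => //; rewrite -linearZ ry linear0.
apply: has_rank_frac_rank; rewrite -finset.setUA.
have := has_rank_quotient_torsion yk fy_tor (frac_rankP _); exact.
Qed.

End MatroidRank.

(** * Loops and coloops *)

Lemma has_rank_prod_regular (R : idomainType) (Q : lmodType R) d :
  has_rank (Q * R^o)%type d -> (0 < d)%N /\ has_rank Q d.-1.
Proof.
have fL : linear (fun p : (Q * R^o)%type => p.1) by [].
have [f fE] := linear_fun fL.
apply: (@has_rank_quotient _ _ _ (0, 1) f).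
  split=> [q|[q s]]; first by exists (q, 0); rewrite fE.
  rewrite fE; split=> [/= ->|[r [-> _]]]; last exact: scaler0.
  by exists s; congr pair; rewrite ?scaler0 // [RHS]mulr1.
move=> [r r0 /(congr1 snd)] /=; rewrite [_ *: _]mulr1 => r0'.
by rewrite r0' eqxx in r0.
Qed.

Section LoopsAndColoops.
Variables (R : idomainType) (E : finType) (M : Rmatroid R E).
Implicit Types (A B : {set E}) (b c i : E).

(** At the empty set, a loop divides out a torsion element of a torsion-free
    module, that is 0.  The isomorphism is carried from [B] to [B + b]: there
    [M (B + i)] is the quotient of [M B] by some [y], and it is isomorphic to
    [M B], so [y = 0] because surjective endomorphisms of finitely generated
    modules are injective.  Hence [M (B + b + i)] is [M (B + b)]. *)
Lemma loop_modiso i A : torsion_free (M finset.set0) -> loop M i ->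
  i \notin A -> M (A :|: [set i]) ≃ M A.
Proof.
move=> M_free i_loop; rewrite /loop rkE in i_loop.
apply: (set_ind_up (P := fun A => i \notin A -> M (A :|: [set i]) ≃ M A)
    _ _ (finset.sub0set A)) => [_|B b _ bB IH].
  have [x [f [f_surj f0]]] := rmatroid_step M (negbT (in_set0 i)).
  apply/modiso_sym/(quotient_bij (f := f)) => // u /f0[r ->].
  have [x_tor|x_tor] := pselect (torsion_elt x); last first.
    have := frac_rank_nontorsion (conj f_surj f0) x_tor.
    by rewrite finset.set0U; lia.
  have [s s0 /M_free[s0'|->]] := x_tor; last by rewrite scaler0.
  by rewrite s0' eqxx in s0.
rewrite inE negb_or => /andP[iB ib].
have [x [y [f [g [h [[f_surj f0] [g_surj g0] [h_surj h0]]]]]]] :=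
  rmatroid_step2 M bB iB.
have y0 : y = 0.
  apply: (fg_surj_endo_inj (f := g) (fgmodP _) (modiso_sym (IH iB)) g_surj).
  by apply/g0; exists 1; rewrite scale1r.
have [k [k_surj k0] _] := quotient_by2_factor (conj f_surj f0)
  (conj h_surj h0).
rewrite -finset.setUA; apply/modiso_sym/(quotient_bij k_surj) => p /k0[r ->].
by rewrite y0 linear0 scaler0.
Qed.

(** Finiteness passes from the torsion duals to every [Ext^1 (M A, R)]: as long
    as [M A] has positive rank, some element lowers it because [M E = 0], and
    [Ext^1] of the quotient surjects onto that of [M A]; in rank 0 the module is
    torsion. *)
Lemma matroid_ext_fg A :
    (forall B, finitely_generated (dual (torsion (M B)))) ->
    (forall m : M [set: E], m = 0) ->
  ext_fg (M A).
Proof.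
move=> M_fin M_zero; move: A; apply: set_ind_down => A IH.
have [A0|] := eqVneq (frac_rank M A) 0%N.
  apply: ext_fg_torsion => //; apply: has_rank0_torsion.
  by rewrite -A0; exact: frac_rankP.
have E0 : frac_rank M [set: E] = 0%N.
  exact/has_rank_frac_rank/has_rank0.
have [loops|] := pselect (forall b, b \notin A ->
    frac_rank M (A :|: [set b]) = frac_rank M A).
  by rewrite -(frac_rank_loops loops) E0 eqxx.
move=> /existsNP[b /not_implyP[bA b_drop]] _.
have [x [f xf]] := rmatroid_step M bA.
apply: (ext_fg_quotient xf (fgmodP _)); last exact: IH.
by move=> x_tor; apply: b_drop; exact: frac_rank_torsion xf x_tor.
Qed.

(** A coloop splits off a free summand, by descending induction.  On the
    complement of [i], the module is cyclic and not torsion, hence free.  In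
    general choose [b] outside [A + i], and let [M (A + b)] and [M (A + i)] be
    the quotients of [M A] by [x] and [y].  By induction [M (A + b)] is
    [M (A + b + i) (+) R], and the image of [y] in it is not torsion for reasons
    of rank, so some functional of [M (A + b)] maps it to 1; composed with the
    quotient map, this functional splits [y] off [M A]. *)
Lemma coloop_modiso i A :
    (forall B, finitely_generated (dual (torsion (M B)))) ->
    (forall m : M [set: E], m = 0) -> coloop M i ->
  i \notin A -> M A ≃ (M (A :|: [set i]) * R^o)%type.
Proof.
move=> M_fin M_zero i_coloop; rewrite /coloop !rkE in i_coloop.
have E0 : frac_rank M [set: E] = 0%N.
  exact/has_rank_frac_rank/has_rank0.
move: A; apply: set_ind_down => A IH iA.
have [A_full|] := eqVneq A (~: [set i]).
  have Ai : A :|: [set i] = [set: E].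
    by rewrite A_full finset.setUC finset.setUCr.
  have rA : frac_rank M A = 1%N.
    by have := frac_rank_anti M (finset.sub0set A); rewrite A_full; lia.
  have [x [g xg]] := rmatroid_step M iA.
  have Q0 (q : M (A :|: [set i])) : q = 0 by move: q; rewrite Ai.
  have x_tor : ~ torsion_elt x.
    by move=> /(frac_rank_torsion xg); rewrite Ai E0 rA.
  have xP u : exists r, u = r *: x.
    by case: xg => _ g0; apply/g0; exact: Q0.
  have /choice[phi phiE] := xP.
  have phi_uniq r s : r *: x = s *: x -> r = s.
    move=> /eqP; rewrite -subr_eq0 -scalerBl => /eqP rs.
    apply/eqP; rewrite -subr_eq0; apply/negPn/negP => rs0.
    by apply: x_tor; exists (r - s).
  have phiL : linear (phi : M A -> R^o).
    move=> a u v; apply: phi_uniq; rewrite -phiE scalerDl -scalerA -!phiE //.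
  have [phi' phi'E] := linear_fun phiL.
  apply: (split_quotient (phi := phi') xg).
  by rewrite phi'E; apply: phi_uniq; rewrite -phiE scale1r.
move=> AN.
have AC : A \subset ~: [set i].
  by apply/subsetP => j jA; rewrite !inE; apply: contraNneq iA => <-.
have /properP[_ [b]] : A \proper ~: [set i] by rewrite properEneq AN.
rewrite !inE => bi bA.
have [x [y [f [g [h [xf yg xyh]]]]]] := rmatroid_step2 M bA iA.
have [k yk _] := quotient_by2_factor xf xyh.
have iAb : i \notin A :|: [set b] by rewrite !inE negb_or iA eq_sym.
have := IH b bA iAb; rewrite -finset.setUA => Ab_split.
have fy_tor : ~ torsion_elt (f y).
  move=> fy_tor; have Pd := frac_rankP M (A :|: [set b]).
  have [d_gt0 Qd1] := has_rank_prod_regular (has_rank_iso Ab_split Pd).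
  have := has_rank_vdim (has_rank_quotient_torsion yk fy_tor Pd).
  by rewrite (has_rank_vdim Qd1); lia.
have [phi phiy] := split_of_iso yk Ab_split (fgmodP _) fy_tor
  (matroid_ext_fg _ M_fin M_zero).
exact: (split_quotient (phi := phi \o f) yg).
Qed.

End LoopsAndColoops.

(** * Deletion and contraction in the Tutte polynomial *)

Section DeletionContraction.
Variables (E : finType) (i : E).
Local Notation E' := {j : E | j != i}.
Implicit Types (B : {set E'}).

Lemma notin_val_imset B : i \notin val @: B.
Proof. by apply/imsetP => -[j _ ij]; have := valP j; rewrite -ij eqxx. Qed.

Lemma val_imsetT : val @: [set: E'] = ~: [set i].
Proof.
apply/setP => j; rewrite !inE; apply/imsetP/idP => [[k _ ->]|ji].
  exact: (valP k).
by exists (Sub j ji); rewrite ?inE // SubK.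
Qed.

Lemma sum_sets_split (V : nmodType) (F : {set E} -> V) :
  \sum_A F A = \sum_(B : {set E'}) (F (val @: B) + F (val @: B :|: [set i])).
Proof.
have valK (B : {set E'}) : val @^-1: (val @: B) = B.
  by apply/setP => j; rewrite inE mem_imset //; exact: val_inj.
have preK (A : {set E}) : val @: (val @^-1: A : {set E'}) = A :\ i.
  apply/setP => j; rewrite !inE; apply/imsetP/andP => [[k kA ->]|[ji jA]].
    by rewrite inE in kA; split; first exact: (valP k).
  by exists (Sub j ji); rewrite ?inE SubK.
rewrite (bigID (fun A : {set E} => i \in A)) /= addrC big_split; congr (_ + _).
  rewrite (reindex_onto (fun B : {set E'} => val @: B)
    (fun A : {set E} => val @^-1: A)) => [|A iA]; last first.
    by rewrite preK; apply/setDidPl; rewrite disjoint_sym disjoints1.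
  by apply: eq_bigl => B; rewrite notin_val_imset valK eqxx.
rewrite (reindex_onto (fun B : {set E'} => val @: B :|: [set i])
  (fun A : {set E} => val @^-1: (A :\ i))) => [|A iA]; last first.
  rewrite preK finset.setUC; have -> : A :\ i :\ i = A :\ i.
    by apply/setP => j; rewrite !inE andbA andbb.
  exact: finset.setD1K.
apply: eq_bigl => B.
rewrite !inE eqxx orbT finset.setUC setU1K ?notin_val_imset //.
by rewrite valK eqxx.
Qed.

Variables (R : idomainType) (M : Rmatroid R E).

Lemma rk_deletion B : rk (deletion M i) B = rk M (val @: B).
Proof. by rewrite /rk /= imset0. Qed.

Lemma rk_deletionT : rk (deletion M i) [set: E'] = rk M (~: [set i]).
Proof. by rewrite rk_deletion val_imsetT. Qed.

Lemma rk_contraction B : rk (contraction M i) B =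
  (frac_rank M [set i] - frac_rank M (val @: B :|: [set i]))%N.
Proof. by rewrite /rk /= imset0 finset.set0U. Qed.

Lemma rk_contractionT : rk (contraction M i) [set: E'] =
  (frac_rank M [set i] - frac_rank M [set: E])%N.
Proof. by rewrite rk_contraction val_imsetT finset.setUC finset.setUCr. Qed.

Lemma card_val_imset B : #|val @: B| = #|B|.
Proof. by rewrite card_imset //; exact: val_inj. Qed.

Lemma card_val_imsetU1 B : #|val @: B :|: [set i]| = #|B|.+1.
Proof. by rewrite finset.setUC cardsU1 notin_val_imset card_val_imset. Qed.

(** Each subset [B] of the complement of [i] contributes the terms of [B] and of
    [B + i]. *)
Lemma tutte_split : tutte M = \sum_(B : {set E'})
  (L0cls (dual (torsion (M (val @: B)))) *:
     ((tx R - 1) ^+ (rk M [set: E] - rk M (val @: B)) *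
      (ty R - 1) ^+ (#|B| - rk M (val @: B))) +
   L0cls (dual (torsion (M (val @: B :|: [set i])))) *:
     ((tx R - 1) ^+ (rk M [set: E] - rk M (val @: B :|: [set i])) *
      (ty R - 1) ^+ (#|B|.+1 - rk M (val @: B :|: [set i])))).
Proof.
rewrite /tutte sum_sets_split; apply: eq_bigr => B _.
by rewrite card_val_imset card_val_imsetU1.
Qed.

Lemma tutte_deletionE : tutte (deletion M i) = \sum_(B : {set E'})
  L0cls (dual (torsion (M (val @: B)))) *:
     ((tx R - 1) ^+ (rk M (~: [set i]) - rk M (val @: B)) *
      (ty R - 1) ^+ (#|B| - rk M (val @: B))).
Proof.
by rewrite /tutte; apply: eq_bigr => B _; rewrite rk_deletionT rk_deletion.
Qed.

Lemma tutte_contractionE : tutte (contraction M i) = \sum_(B : {set E'})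
  L0cls (dual (torsion (M (val @: B :|: [set i])))) *:
     ((tx R - 1) ^+ (rk (contraction M i) [set: E'] - rk (contraction M i) B) *
      (ty R - 1) ^+ (#|B| - rk (contraction M i) B)).
Proof. by []. Qed.

(** The terms of [B] and [B + i] have the same coefficient and the same power of
    [x - 1], and their powers of [y - 1] differ by one factor: they add up to
    [y] times the term of the deletion. *)
Lemma tutte_loop : torsion_free (M finset.set0) -> loop M i ->
  tutte M = ty R * tutte (deletion M i).
Proof.
move=> M_free i_loop.
have isoU (A : {set E}) : i \notin A -> M (A :|: [set i]) ≃ M A.
  exact: loop_modiso.
have rankU (A : {set E}) : i \notin A -> rk M (A :|: [set i]) = rk M A.
  move=> /isoU iso; rewrite !rkE; congr (_ - _)%N.
  exact/has_rank_frac_rank/(has_rank_iso (modiso_sym iso))/frac_rankP.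
have rankE : rk M [set: E] = rk M (~: [set i]).
  by rewrite -(rankU (~: [set i])) ?inE ?eqxx // finset.setUC finset.setUCr.
rewrite tutte_split tutte_deletionE mulr_sumr; apply: eq_bigr => B _.
have iB := notin_val_imset B.
rewrite (L0cls_dual_torsion (isoU _ iB)) rankU // rankE.
have := rk_le_card M (val @: B); rewrite card_val_imset => rkB.
rewrite subSn // exprSr -scalerDr -scalerAr; congr (_ *: _).
move: (_ ^+ _) (_ ^+ _) => a b.
by rewrite -mulrDr mulrBr mulr1 addrC subrK mulrA mulrC.
Qed.

(** Here the powers of [y - 1] agree and the term of [B] has one more factor
    [x - 1], so the two terms add up to [x] times the term of the
    contraction. *)
Lemma tutte_coloop :
    (forall A, finitely_generated (dual (torsion (M A)))) ->
    (forall m : M [set: E], m = 0) -> coloop M i ->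
  tutte M = tx R * tutte (contraction M i).
Proof.
move=> M_fin M_zero i_coloop.
have isoU (A : {set E}) : i \notin A -> M A ≃ (M (A :|: [set i]) * R^o)%type.
  exact: coloop_modiso.
have rankU (A : {set E}) : i \notin A ->
    frac_rank M A = (frac_rank M (A :|: [set i])).+1.
  move=> /isoU iso.
  have [d_gt0 d1] := has_rank_prod_regular (has_rank_iso iso (frac_rankP M A)).
  by rewrite (has_rank_frac_rank d1) prednK.
have rank0 : frac_rank M finset.set0 = (frac_rank M [set i]).+1.
  by rewrite rankU ?inE // finset.set0U.
rewrite tutte_split tutte_contractionE mulr_sumr; apply: eq_bigr => B _.
have iB := notin_val_imset B.
have -> : L0cls (dual (torsion (M (val @: B)))) =
    L0cls (dual (torsion (M (val @: B :|: [set i])))).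
  by rewrite (L0cls_dual_torsion (isoU _ iB)) L0cls_dual_torsion_prod_regular.
rewrite rk_contractionT rk_contraction !rkE (rankU _ iB) rank0.
have le1 : (frac_rank M (val @: B :|: [set i]) <= frac_rank M [set i])%N.
  by apply: frac_rank_anti; exact: finset.subsetUr.
have le2 : (frac_rank M [set: E] <= frac_rank M (val @: B :|: [set i]))%N.
  by apply: frac_rank_anti; exact: finset.subsetT.
set p := frac_rank M [set: E] in le2 *.
set q := frac_rank M (_ :|: _) in le1 le2 *.
set s := frac_rank M [set i] in le1 *.
have -> : (s.+1 - p - (s.+1 - q.+1) = (q - p).+1)%N by lia.
have -> : (s.+1 - p - (s.+1 - q) = q - p)%N by lia.
have -> : (s - p - (s - q) = q - p)%N by lia.
have -> : (#|B|.+1 - (s.+1 - q) = #|B| - (s - q))%N by lia.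
have -> : (#|B| - (s.+1 - q.+1) = #|B| - (s - q))%N by lia.
rewrite exprS -scalerDr -scalerAr; congr (_ *: _).
move: (_ ^+ _) (_ ^+ _) => a b.
by rewrite -mulrA mulrBl mul1r subrK.
Qed.

(** The terms of [B] are those of the deletion, which has the rank of [M], and
    the terms of [B + i] are those of the contraction, whose rank function is
    that of [M] at [B + i] lowered by 1. *)
Lemma tutte_other : ~ loop M i -> ~ coloop M i ->
  tutte M = tutte (deletion M i) + tutte (contraction M i).
Proof.
move=> i_nloop i_ncoloop.
have rank0 : frac_rank M finset.set0 = (frac_rank M [set i]).+1.
  have := frac_rank_step M (negbT (in_set0 i)); rewrite finset.set0U.
  by case=> // fr; case: i_nloop; rewrite /loop rkE fr subnn.
have i_notin : i \notin ~: [set i] by rewrite !inE eqxx.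
have rankE : frac_rank M [set: E] = frac_rank M (~: [set i]).
  have := frac_rank_step M i_notin; rewrite finset.setUC finset.setUCr.
  case=> // fr; case: i_ncoloop; rewrite /coloop !rkE.
  by have := frac_rank_anti M (finset.sub0set (~: [set i])); lia.
rewrite tutte_split tutte_deletionE tutte_contractionE -big_split.
apply: eq_bigr => B _.
rewrite rk_contractionT rk_contraction !rkE rankE rank0.
have le1 : (frac_rank M (val @: B :|: [set i]) <= frac_rank M [set i])%N.
  by apply: frac_rank_anti; exact: finset.subsetUr.
congr (_ + _ *: (_ ^+ _ * _ ^+ _)); last by lia.
have le2 : (frac_rank M [set: E] <= frac_rank M (val @: B :|: [set i]))%N.
  by apply: frac_rank_anti; exact: finset.subsetT.
by move: le2; rewrite rankE; lia.
Qed.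

End DeletionContraction.

Theorem theorem2p8 (R : idomainType) (n : nat) (M : Rmatroid R 'I_n)
  (M_fin : forall A : {set 'I_n}, finitely_generated (dual (torsion (M A))))
  (M_free : torsion_free (M set0))
  (M_zero : forall m : M [set: 'I_n], m = 0)
  (i : 'I_n) :
  [/\ loop M i -> tutte M = ty R * tutte (deletion M i),
      coloop M i -> tutte M = tx R * tutte (contraction M i) &
      ~ loop M i -> ~ coloop M i ->
        tutte M = tutte (deletion M i) + tutte (contraction M i)].
Proof.
split; [exact: tutte_loop|exact: tutte_coloop|exact: tutte_other].
Qed.
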